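(* Let $A \subseteq \mathbb{R}^2$ be finite and generic, and let $P_2$ be a maximal level-$2$ hypertriangulation of $A$. Then $P_2$ has the local angle property if and only if it is the order-$2$ Delaunay triangulation of $A$.
   Context: A finite set $A\subseteq\mathbb{R}^2$ is generic if no three of its points are collinear and no four are cocircular. A triangulation of a finite set $S\subseteq\mathbb{R}^2$ is an edge-to-edge subdivision of $\mathrm{conv}\,S$ into triangles whose vertices are points of $S$ (not necessarily all of them); it is identified with its set of triangles. For distinct points $a,b \in A$, $[ab]=\frac12(a+b)$, and $A^{(2)}$ is the set of all such midpoints. A level-$2$ hypertriangulation of $A$ (where $\#A\ge 3$) is a (possibly partial) triangulation of the point set $A^{(2)}$ such that every edge with endpoints $[I]$ and $[J]$ ($I,J\subseteq A$ of size $2$) satisfies $\#(I\cap J)=1$. Each vertex carries one label $I$: if a point of $A^{(2)}$ is the midpoint of several pairs, a hypertriangulation using it as a vertex uses only one of these labels. A triangle with vertices $[I],[J],[K]$ is black if $I\cap J\cap K=\emptyset$ (so its vertices are $[ab],[ac],[bc]$) and white if $\#(I\cap J\cap K)=1$ (so its vertices are $[ya],[yb],[yc]$). A level-$2$ hypertriangulation of $A$ is maximal if no other level-$2$ hypertriangulation of $A$ subdivides it. Order-$2$ Delaunay triangulation of $A$: the level-$2$ hypertriangulation consisting of (i) all black triangles with vertices $[ab],[ac],[bc]$, where $a,b,c\in A$ and the circumcircle of $abc$ has no points of $A$ inside; and (ii) all white triangles with vertices $[ya],[yb],[yc]$, where $a,b,c,y\in A$ and $y$ is the only point of $A$ inside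 the circumcircle of $abc$. Local angle property: a level-$2$ hypertriangulation of $A$ has the local angle property if (ww) for every edge shared by two white triangles, the sum of the two angles opposite the edge is at most $\pi$; (bb) for every edge shared by two black triangles, the sum of the two angles opposite the edge is at least $\pi$; (bw) for every edge shared by a black triangle and a white triangle, the angle opposite the edge in the black triangle is bigger than the angle opposite the edge in the white triangle. *)

(* Defs.v *)
From mathcomp Require Import all_boot all_order all_algebra finmap.
From mathcomp Require Import boolp classical_sets reals topology trigo convex.

Set Implicit Arguments.
Unset Strict Implicit.
Unset Printing Implicit Defensive.

Import Order.TTheory GRing.Theory Num.Theory.
Local Open Scope ring_scope.

(* The norm `|_| that the library puts on row vectors is the sup norm, hence
   the separate Euclidean distance. *)
Definition dot (R : realType) (u v : 'rV[R]_2) : R := \sum_i u 0 i * v 0 i.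

Definition dist (R : realType) (p q : 'rV[R]_2) : R :=
  Num.sqrt (dot (p - q) (p - q)).

Definition angle (R : realType) (p q r : 'rV[R]_2) : R :=
  acos (dot (p - q) (r - q) / (dist p q * dist r q)).

Definition collinear (R : realType) (s : seq 'rV[R]_2) : Prop :=
  exists p v, forall x, x \in s -> exists k : R, x = p + k *: v.

Definition cocircular (R : realType) (s : seq 'rV[R]_2) : Prop :=
  exists o r, forall x, x \in s -> dist x o = r.

Definition generic (R : realType) (A : {fset 'rV[R]_2}) : Prop :=
  (forall s, {subset s <= A} -> uniq s -> size s = 3%N -> ~ collinear s) /\
  (forall s, {subset s <= A} -> uniq s -> size s = 4%N -> ~ cocircular s).

Definition inside_circumcircle (R : realType) (a b c p : 'rV[R]_2) : Prop :=
  exists o r, [/\ dist a o = r, dist b o = r, dist c o = r & dist p o < r].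

Definition conv_hull (R : realType) (S : set 'rV[R]_2) : set 'rV[R]_2 :=
  smallest (@convex_set R 'rV[R]_2) S.

(* A triangle is given by its set of vertices. *)
Definition is_triangle (R : realType) (t : set 'rV[R]_2) : Prop :=
  exists a b c, t = [set a; b; c]%classic /\ ~ collinear [:: a; b; c].

Definition is_triangulation (R : realType)
    (S : set 'rV[R]_2) (T : set (set 'rV[R]_2)) : Prop :=
  [/\ forall t, T t -> is_triangle t /\ (t `<=` S)%classic,
      (\bigcup_(t in T) conv_hull t)%classic = conv_hull S &
      forall s t, T s -> T t ->
        (conv_hull s `&` conv_hull t)%classic = conv_hull (s `&` t)%classic].

(* A label is a two-element I : {set A}; a labelled triangle is the set of the
   labels of its three vertices. *)
Definition mid (R : realType) (A : {fset 'rV[R]_2}) (I : {set A}) : 'rV[R]_2 :=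
  2^-1 *: \sum_(x in I) val x.

Definition midpoints (R : realType) (A : {fset 'rV[R]_2}) : set 'rV[R]_2 :=
  [set mid I | I in [set I : {set A} | #|I| = 2%N]]%classic.

Definition corners (R : realType) (A : {fset 'rV[R]_2})
    (t : {set {set A}}) : set 'rV[R]_2 :=
  [set mid I | I in [set` t]]%classic.

(* finset.cover P is the set of labels used by P. *)
Definition is_hypertriangulation (R : realType) (A : {fset 'rV[R]_2})
    (P : {set {set {set A}}}) : Prop :=
  [/\ {in finset.cover P, forall I : {set A}, #|I| = 2%N},
      {in finset.cover P &, injective (@mid R A)},
      is_triangulation (@midpoints R A) [set corners t | t in [set` P]]%classic &
      forall t I J, t \in P -> I \in t -> J \in t -> I != J ->
        #|(I :&: J)%SET| = 1%N].

(* Every vertex of P stays a vertex of Q, with the same label.  Without labels,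
   a mere relabelling of P (at the centre of a parallelogram of points of A)
   would count as another hypertriangulation subdividing P. *)
Definition subdivides (R : realType) (A : {fset 'rV[R]_2})
    (Q P : {set {set {set A}}}) : Prop :=
  finset.cover P \subset finset.cover Q /\
  forall s, s \in Q ->
    exists2 t, t \in P & (conv_hull (corners s) `<=` conv_hull (corners t))%classic.

Definition maximal_hypertriangulation (R : realType) (A : {fset 'rV[R]_2})
    (P : {set {set {set A}}}) : Prop :=
  is_hypertriangulation P /\
  forall Q, is_hypertriangulation Q -> subdivides Q P -> Q = P.

Definition black (T : finType) (t : {set {set T}}) : bool :=
  (\bigcap_(I in t) I)%SET == finset.set0.

Definition white (T : finType) (t : {set {set T}}) : bool :=
  #|(\bigcap_(I in t) I)%SET| == 1%N.

Definition delaunay_black (R : realType) (A : {fset 'rV[R]_2})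
    (t : {set {set A}}) : Prop :=
  exists a b c : A,
    [/\ uniq [:: a; b; c],
        forall p : A, ~ inside_circumcircle (val a) (val b) (val c) (val p) &
        t = [set [set a; b]; [set a; c]; [set b; c]]%SET].

Definition delaunay_white (R : realType) (A : {fset 'rV[R]_2})
    (t : {set {set A}}) : Prop :=
  exists a b c y : A,
    [/\ uniq [:: a; b; c],
        forall p : A,
          inside_circumcircle (val a) (val b) (val c) (val p) <-> p = y &
        t = [set [set y; a]; [set y; b]; [set y; c]]%SET].

Definition order2_delaunay (R : realType) (A : {fset 'rV[R]_2}) :
    {set {set {set A}}} :=
  [set t | `[< delaunay_black t \/ delaunay_white t >]]%SET.

(* s and t share the edge with endpoints I, J, opposite to K in s and to L
   in t. *)
Definition share_edge (T : finType) (s t : {set {set T}}) (I J K L : {set T}) :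
    Prop :=
  [/\ s <> t, uniq [:: I; J; K], uniq [:: I; J; L],
      s = [set I; J; K]%SET & t = [set I; J; L]%SET].

Definition local_angle_property (R : realType) (A : {fset 'rV[R]_2})
    (P : {set {set {set A}}}) : Prop :=
  forall s t I J K L, s \in P -> t \in P -> share_edge s t I J K L ->
  let angle_s := angle (mid I) (mid K) (mid J) in
  let angle_t := angle (mid I) (mid L) (mid J) in
  [/\ white s -> white t -> angle_s + angle_t <= pi,
      black s -> black t -> pi <= angle_s + angle_t &
      black s -> white t -> angle_t < angle_s].

(* Main.v *)
Require Import Defs.
From mathcomp Require Import all_boot all_order all_algebra finmap.
From mathcomp Require Import boolp classical_sets reals topology trigo convex.
From mathcomp Require Import interval_inference ring lra.

(** Lift [mid I] to the height [\sum_(p in I) |p|^2].  The local angle conditions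
    say that the lifted surface of [P2] is strictly convex along every shared
    edge: after scaling by 2 from the common point y of the labels of the edge,
    both are in-circle tests.  Each global statement then follows from a finite
    extremal argument in place of a walk through the triangulation: among all
    counterexamples (triangle, vertex) or (triangle, point of A) take one in which
    the violation is largest; crossing the edge of the triangle that separates it
    from the offending point leads to a neighbour with a larger violation.  This
    shows in turn that no vertex lies below the plane of a triangle, that the
    common point of a white triangle lies inside its circle, and that no other
    point of A lies inside the circle of a triangle.  Maximality only serves in
    the last step: a point d of A inside abc, for a white triangle [ya][yb][yc],
    would allow a subdivision at [yd].  Hence every triangle of [P2] is Delaunay,
    and the Delaunay triangles leave no room for others. *)

Set Implicit Arguments.
Unset Strict Implicit.
Unset Printing Implicit Defensive.

Import Order.TTheory GRing.Theory Num.Theory.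
Local Open Scope ring_scope.

(** * Circles and the in-circle test *)

Section Plane.
Variable R : realType.
Implicit Types (a b c p q u v x y : 'rV[R]_2) (k r : R).

(** The later descents therefore follow powers of points with respect to circles, and call on
    heights only at vertices known to be in use. Both quantities obey one law. For two triangles
    with a common edge, the difference of heights is affine and vanishes on that edge; for two
    circles through b and c, the difference of powers is affine and vanishes on the line bc. So each
    difference is a barycentric coordinate times its value at a single vertex ([excess_weights],
    [pow_weights]). The sign of the coordinate selects the edge to cross, and local convexity, or
    its consequence [excess_cover], gives the sign of the other factor. This is why one crossing
    already contradicts extremality, whatever lies further on. *)

Definition cross u v : R := u 0 0 * v 0 1 - u 0 1 * v 0 0.

Lemma dotE u v : dot u v = u 0 0 * v 0 0 + u 0 1 * v 0 1.
Proof.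
rewrite /dot 2!big_ord_recl big_ord0 addr0.
by have -> : lift ord0 ord0 = 1 :> 'I_2 by apply/val_inj.
Qed.

Lemma rV2P u v : u = v <-> u 0 0 = v 0 0 /\ u 0 1 = v 0 1.
Proof.
split=> [-> //|[e0 e1]]; apply/rowP => i.
have [->|->] : i = 0 \/ i = 1 by case: i => [[|[|//]] ?]; [left|right]; apply/val_inj.
  by [].
by [].
Qed.

Lemma noncollinearP a b c :
  ~ collinear [:: a; b; c] <-> cross (b - a) (c - a) != 0.
Proof.
split=> [nc|/eqP nz [p [v h]]].
  apply/eqP; rewrite /cross !mxE => z; apply: nc.
  have [e|ne] := eqVneq a b.
    exists a, (c - a) => x; rewrite !inE => /or3P[] /eqP ->.
    - by exists 0; rewrite scale0r addr0.
    - by exists 0; rewrite scale0r addr0.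
    - by exists 1; rewrite scale1r addrC subrK.
  exists a, (b - a) => x; rewrite !inE => /or3P[] /eqP ->.
  - by exists 0; rewrite scale0r addr0.
  - by exists 1; rewrite scale1r addrC subrK.
  have [e0|n0] := eqVneq (a 0 0) (b 0 0).
    have n1 : b 0 1 - a 0 1 != 0.
      by rewrite subr_eq0; apply: contra_neq ne => e1; apply/rV2P.
    exists ((c 0 1 - a 0 1) / (b 0 1 - a 0 1)); apply/rV2P.
    rewrite !mxE; split; last by field.
    move: z; rewrite e0 subrr mul0r sub0r mulr0 addr0 => /eqP.
    by rewrite oppr_eq0 mulf_eq0 (negPf n1) /= subr_eq0 => /eqP.
  have n1 : b 0 0 - a 0 0 != 0 by rewrite subr_eq0 eq_sym.
  exists ((c 0 0 - a 0 0) / (b 0 0 - a 0 0)); apply/rV2P.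
  rewrite !mxE; split; first by field.
  apply: (mulfI n1); set k := _ / _.
  have : k * (b 0 0 - a 0 0) * (b 0 1 - a 0 1) = (c 0 0 - a 0 0) * (b 0 1 - a 0 1).
    by rewrite mulfVK.
  lra.
have [k1 e1] := h a (mem_head _ _).
have [|k2 e2] := h b; first by rewrite !inE eqxx orbT.
have [|k3 e3] := h c; first by rewrite !inE eqxx !orbT.
by apply: nz; rewrite /cross e1 e2 e3 !mxE; ring.
Qed.

(** The power of [x] with respect to the circle with centre [C.1 / 2]. In this form no square root
    occurs, the circle through three points solves a linear system, and the difference of two powers
    is affine in [x]. *)
Definition pow (C : 'rV[R]_2 * R) x : R := dot x x - dot C.1 x - C.2.

Lemma circle_exists a b c : cross (b - a) (c - a) != 0 ->
  exists C, [/\ pow C a = 0, pow C b = 0 & pow C c = 0].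
Proof.
set D := cross _ _ => nz.
pose B := dot b b - dot a a; pose G := dot c c - dot a a.
(* Cramer's rule for the equations [dot w (b - a) = B] and [dot w (c - a) = G]. *)
pose w : 'rV[R]_2 := \row_i (if i == 0 then
  (B * (c 0 1 - a 0 1) - G * (b 0 1 - a 0 1)) / D
  else (G * (b 0 0 - a 0 0) - B * (c 0 0 - a 0 0)) / D).
have w0 : w 0 0 = (B * (c 0 1 - a 0 1) - G * (b 0 1 - a 0 1)) / D by rewrite mxE.
have w1 : w 0 1 = (G * (b 0 0 - a 0 0) - B * (c 0 0 - a 0 0)) / D by rewrite mxE.
exists (w, dot a a - dot w a); rewrite /pow /=; split; first by ring.
  rewrite (dotE w) (dotE w) w0 w1.
  suff : B = (B * (c 0 1 - a 0 1) - G * (b 0 1 - a 0 1)) / D * (b 0 0 - a 0 0)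
    + (G * (b 0 0 - a 0 0) - B * (c 0 0 - a 0 0)) / D * (b 0 1 - a 0 1).
    rewrite {1}/B; lra.
  by move: nz; rewrite /D /cross !mxE => nz; field.
rewrite (dotE w) (dotE w) w0 w1.
suff : G = (B * (c 0 1 - a 0 1) - G * (b 0 1 - a 0 1)) / D * (c 0 0 - a 0 0)
  + (G * (b 0 0 - a 0 0) - B * (c 0 0 - a 0 0)) / D * (c 0 1 - a 0 1).
  rewrite {1}/G; lra.
by move: nz; rewrite /D /cross !mxE => nz; field.
Qed.

Lemma dot_ge0 u : 0 <= dot u u.
Proof. by rewrite dotE -!expr2 addr_ge0 ?sqr_ge0. Qed.

Lemma le_dist p q o : (dist p o <= dist q o) = (dot (p - o) (p - o) <= dot (q - o) (q - o)).
Proof. by rewrite /dist ler_sqrt ?dot_ge0. Qed.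

Definition center (C : 'rV[R]_2 * R) : 'rV[R]_2 := 2^-1 *: C.1.

Lemma le_dist_center C p q : (dist p (center C) <= dist q (center C)) = (pow C p <= pow C q).
Proof. by rewrite le_dist /pow !dotE !mxE; apply/idP/idP; lra. Qed.

Lemma center_unique a b c o o' :
  cross (b - a) (c - a) != 0 ->
  dist a o = dist b o -> dist a o = dist c o ->
  dist a o' = dist b o' -> dist a o' = dist c o' -> o = o'.
Proof.
move=> nz; have dE p q s : dist p s = dist q s -> dot (p - s) (p - s) = dot (q - s) (q - s).
  by move=> e; apply/eqP; rewrite eq_le -!le_dist e lexx.
move=> /dE e1 /dE e2 /dE e3 /dE e4; move: e1 e2 e3 e4.
rewrite !dotE !mxE => e1 e2 e3 e4; apply/rV2P.
(* Subtracting the equations for [o] and [o'] cancels the squares: [o - o'] is orthogonal to two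
   independent sides of the triangle. *)
have E1 : (o 0 0 - o' 0 0) * (b 0 0 - a 0 0) + (o 0 1 - o' 0 1) * (b 0 1 - a 0 1) = 0 by lra.
have E2 : (o 0 0 - o' 0 0) * (c 0 0 - a 0 0) + (o 0 1 - o' 0 1) * (c 0 1 - a 0 1) = 0 by lra.
have eqD (x y : R) : (cross (b - a) (c - a)) * (x - y) = 0 -> x = y.
  by move/eqP; rewrite mulf_eq0 (negPf nz) subr_eq0 => /eqP.
split; apply: eqD; rewrite /cross !mxE.
  have := congr1 ( *%R (c 0 1 - a 0 1)) E1; have := congr1 ( *%R (b 0 1 - a 0 1)) E2; lra.
have := congr1 ( *%R (c 0 0 - a 0 0)) E1; have := congr1 ( *%R (b 0 0 - a 0 0)) E2; lra.
Qed.

Lemma inside_circumcircleP C a b c p : cross (b - a) (c - a) != 0 ->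
  pow C a = 0 -> pow C b = 0 -> pow C c = 0 ->
  inside_circumcircle a b c p <-> pow C p < 0.
Proof.
move=> nz Ca Cb Cc.
have eab : dist a (center C) = dist b (center C).
  by apply/eqP; rewrite eq_le !le_dist_center Ca Cb lexx.
have eac : dist a (center C) = dist c (center C).
  by apply/eqP; rewrite eq_le !le_dist_center Ca Cc lexx.
split=> [[o [r [ea eb ec lt]]]|lt].
  have eo := center_unique nz eab eac (etrans ea (esym eb)) (etrans ea (esym ec)).
  by move: lt; rewrite -ea -eo !ltNge le_dist_center Ca.
exists (center C), (dist a (center C)); split=> //.
by rewrite ltNge le_dist_center Ca -ltNge.
Qed.

Lemma pow_cocircular C r (s : seq 'rV[R]_2) :
  (forall x, x \in s -> pow C x = 0) -> cocircular s.
Proof.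
case: s => [|a s] h; first by exists 0, 0.
exists (center C), (dist a (center C)) => x xs.
by apply/eqP; rewrite eq_le !le_dist_center !h ?mem_head ?lexx.
Qed.

(** A quantitative inscribed angle theorem: divided by the two cross products, it says how far the
    cotangents of the angles over ab at [p] and at [q] differ. The two sides differ by a combination
    of the powers of [a], [b] and [q], which vanish. *)
Lemma pow_circle C a b q p : pow C a = 0 -> pow C b = 0 -> pow C q = 0 ->
  dot (a - p) (b - p) * cross (a - q) (b - q)
  - dot (a - q) (b - q) * cross (a - p) (b - p) = cross (a - q) (b - q) * pow C p.
Proof.
move=> ha hb hq; apply/eqP; rewrite -subr_eq0; apply/eqP.
transitivity (- (cross (b - p) (q - p) * pow C a + cross (q - p) (a - p) * pow C b
    + cross (a - p) (b - p) * pow C q)).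
  by rewrite /pow /cross !dotE !mxE; ring.
by rewrite ha hb hq !mulr0 !addr0 oppr0.
Qed.
End Plane.

Lemma big_set3 (V : nmodType) (T : finType) (i j k : T) (F : T -> V) :
  uniq [:: i; j; k] -> \sum_(m in [set i; j; k]%SET) F m = F i + F j + F k.
Proof.
move=> u; rewrite (eq_bigl (mem [:: i; j; k])); last first.
  by move=> m; rewrite !inE orbA.
by rewrite -big_uniq //= !big_cons big_nil addr0 addrA.
Qed.

(** * Barycentric coordinates *)

Section Weights.
Variables (R : realType) (T : finType) (f : T -> 'rV[R]_2).
Implicit Types (t s : {set T}) (l : T -> R) (x y : 'rV[R]_2).

Lemma convex_setP (S : set 'rV[R]_2) :
  @convex_set R 'rV[R]_2 S <->
  forall x y c, 0 <= c <= 1 -> S x -> S y -> S (c *: x + (1 - c) *: y).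
Proof.
split=> [cS x y c /andP[c0 c1] Sx Sy|h x y c].
  have := cS x y (Itv01 c0 c1); rewrite !in_setE; exact.
rewrite !in_setE => Sx Sy; apply: h => //.
by apply/andP; split; [exact: ge0 | exact: le1].
Qed.

Lemma conv_hull_convex (S : set 'rV[R]_2) x y c : 0 <= c <= 1 ->
  conv_hull S x -> conv_hull S y -> conv_hull S (c *: x + (1 - c) *: y).
Proof.
move=> c01 Sx Sy M [cM SM]; move/convex_setP: (cM); apply => //.
  by apply: Sx.
by apply: Sy.
Qed.

Lemma sub_conv_hull (S : set 'rV[R]_2) x : S x -> conv_hull S x.
Proof. by move=> Sx M [_]; apply. Qed.

(** Barycentric coordinates with signs allowed, since a negative one tells which edge separates [x]
    from the triangle. [f] is later [mid] on labels and [val] on points of A. *)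
Definition weights t l x :=
  \sum_(i in t) l i = 1 /\ \sum_(i in t) l i *: f i = x.

Lemma weights_conv t l l' x y c : weights t l x -> weights t l' y ->
  weights t (fun i => c * l i + (1 - c) * l' i) (c *: x + (1 - c) *: y).
Proof.
move=> [s1 s2] [s1' s2']; split.
  by rewrite big_split /= -!mulr_sumr s1 s1' !mulr1 addrC subrK.
under eq_bigr do rewrite scalerDl -!scalerA.
by rewrite big_split /= -!scaler_sumr s2 s2'.
Qed.

Lemma weights_vertex t i : i \in t -> weights t (fun j => (j == i)%:R) (f i).
Proof.
move=> ti; split; rewrite (bigD1 i) //= eqxx ?scale1r big1 ?addr0 // => j /andP[_ /negPf ->] //.
by rewrite scale0r.
Qed.

Lemma weights_sub s t l x : s \subset t -> weights s l x ->
  weights t (fun i => if i \in s then l i else 0) x.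
Proof.
move=> /finset.setIidPr st [s1 s2].
split; [rewrite -s1 | rewrite -s2].
  rewrite -big_mkcondr; apply: eq_bigl => i.
  by rewrite -{2}st inE.
rewrite [RHS](eq_bigl (fun i => (i \in t) && (i \in s))); last first.
  by move=> i; rewrite -{1}st inE.
by rewrite [RHS]big_mkcondr; apply: eq_bigr => i _; case: ifP => //; rewrite scale0r.
Qed.

Lemma conv_hull_weights t x :
  conv_hull [set f i | i in [set` t]]%classic x <->
  exists2 l, weights t l x & forall i, i \in t -> 0 <= l i.
Proof.
split=> [|[l [s1 s2] l0] M [/convex_setP cM SM]].
  move=> /(_ [set y | exists2 l, weights t l y & forall i, i \in t -> 0 <= l i]%classic).
  apply; split.
    apply/convex_setP => y z c /andP[c0 c1] [l wl l0] [l' wl' l0'].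
    exists (fun i => c * l i + (1 - c) * l' i); first exact: weights_conv.
    by move=> i ti; rewrite addr_ge0 // mulr_ge0 ?l0 ?l0' ?subr_ge0.
  move=> _ [i /= ti <-].
  by exists (fun j => (j == i)%:R); [exact: weights_vertex | move=> j _; rewrite ler0n].
(* The vertices are absorbed one at a time. Partial sums have to be renormalised, hence the guard on
   their mass; a tail of mass zero is dropped. *)
suff H (r : seq T) : {subset r <= t} -> 0 < \sum_(i <- r) l i ->
    M ((\sum_(i <- r) l i)^-1 *: \sum_(i <- r) l i *: f i).
  have := H (enum t); rewrite !big_enum s1 s2 invr1 scale1r; apply=> //.
  by move=> i; rewrite mem_enum.
elim: r => [|i r IH] sr; first by rewrite big_nil ltxx.
have ti : i \in t by apply: sr; rewrite mem_head.
have sr' : {subset r <= t} by move=> j jr; apply: sr; rewrite inE jr orbT.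
have Mi : M (f i) by apply: SM; exists i.
rewrite !big_cons => pos.
have r0 : 0 <= \sum_(j <- r) l j.
  by rewrite big_seq sumr_ge0 // => j /sr' /l0.
have [e|ne] := eqVneq (\sum_(j <- r) l j) 0.
  have -> : \sum_(j <- r) l j *: f j = 0.
    rewrite big_seq big1 // => j jr.
    suff -> : l j = 0 by rewrite scale0r.
    apply/eqP; move/eqP: e; rewrite big_seq psumr_eq0.
      by move=> /allP /(_ _ jr); rewrite jr.
    by move=> k /sr' /l0.
  move: pos; rewrite e !addr0 => pos.
  by rewrite scalerA mulVf ?scale1r // gt_eqF.
have {}r0 : 0 < \sum_(j <- r) l j by rewrite lt_neqAle eq_sym ne.
have := cM (f i) _ (l i / (l i + \sum_(j <- r) l j)) _ Mi (IH sr' r0).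
have -> : 1 - l i / (l i + \sum_(j <- r) l j) =
  (\sum_(j <- r) l j) / (l i + \sum_(j <- r) l j).
  by field; rewrite gt_eqF.
rewrite scalerA mulrAC divff ?gt_eqF // mul1r scalerDr scalerA [_^-1 * l i]mulrC; apply.
by rewrite divr_ge0 ?l0 ?(ltW pos) //= ler_pdivrMr // mul1r lerDl ltW.
Qed.

Lemma dot_sumr (w : 'rV[R]_2) (r : seq T) (P : pred T) (g : T -> 'rV[R]_2) :
  dot w (\sum_(i <- r | P i) g i) = \sum_(i <- r | P i) dot w (g i).
Proof.
apply: (big_morph (dot w)) => [x y|]; rewrite !dotE !mxE; ring.
Qed.

Lemma weights_affine t l x w (k : R) : weights t l x ->
  dot w x + k = \sum_(i in t) l i * (dot w (f i) + k).
Proof.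
move=> [s1 <-]; rewrite dot_sumr.
under [RHS]eq_bigr do rewrite mulrDr.
rewrite big_split /= -mulr_suml s1 mul1r; congr (_ + _).
by apply: eq_bigr => i _; rewrite !dotE !mxE; ring.
Qed.

(* [f] maps [t] to the vertices of a nondegenerate triangle. *)
Definition simplex t :=
  (forall l l' x, weights t l x -> weights t l' x -> {in t, l =1 l'}) /\
  (forall x, exists l, weights t l x).

Lemma simplex_triangle i j k : uniq [:: i; j; k] ->
  cross (f j - f i) (f k - f i) != 0 -> simplex [set i; j; k]%SET.
Proof.
move=> u nz; split=> [l l' x [s1 <-] [s1' /rV2P]|x].
  rewrite !big_set3 // !mxE => -[e0 e1].
  rewrite !big_set3 // in s1 s1'.
  have D0 (y : R) : cross (f j - f i) (f k - f i) * y = 0 -> y = 0.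
    by move/eqP; rewrite mulf_eq0 (negPf nz) => /eqP.
  have ei : l i = 1 - l j - l k by rewrite -s1; ring.
  have ei' : l' i = 1 - l' j - l' k by rewrite -s1'; ring.
  have E0 : (l' j - l j) * (f j 0 0 - f i 0 0) + (l' k - l k) * (f k 0 0 - f i 0 0) = 0.
    by move: e0; rewrite ei ei'; lra.
  have E1 : (l' j - l j) * (f j 0 1 - f i 0 1) + (l' k - l k) * (f k 0 1 - f i 0 1) = 0.
    by move: e1; rewrite ei ei'; lra.
  have ej : l' j - l j = 0.
    apply: D0; rewrite /cross !mxE.
    have := congr1 ( *%R (f k 0 1 - f i 0 1)) E0.
    have := congr1 ( *%R (f k 0 0 - f i 0 0)) E1; lra.
  have ek : l' k - l k = 0.
    apply: D0; rewrite /cross !mxE.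
    have := congr1 ( *%R (f j 0 1 - f i 0 1)) E0.
    have := congr1 ( *%R (f j 0 0 - f i 0 0)) E1; lra.
  by move=> m; rewrite !inE -orbA => /or3P[] /eqP ->; lra.
pose D := cross (f j - f i) (f k - f i).
pose lj := cross (x - f i) (f k - f i) / D.
pose lk := cross (f j - f i) (x - f i) / D.
have /and3P[] : [&& i != j, i != k & j != k].
  by move: u; rewrite /= !inE negb_or andbT andbA.
move=> ij ik jk.
exists (fun m => if m == j then lj else if m == k then lk else 1 - lj - lk).
split; rewrite big_set3 // !eqxx (negPf ij) (negPf ik) eq_sym (negPf jk) ?eqxx.
  ring.
by apply/rV2P; rewrite !mxE /lj /lk /D; move: nz; rewrite /cross !mxE => nz; split; field.
Qed.

End Weights.

(** * Comparison of angles through their cotangents *)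

Section Angles.
Variable R : realType.
Implicit Types (c d : R) (p q r : 'rV[R]_2).

Lemma le_sqr c d : 0 <= c -> 0 <= d -> (c <= d) = (c ^+ 2 <= d ^+ 2).
Proof. by move=> c0 d0; symmetry; apply: ler_pXn2r. Qed.

(* The cosine of the angle between two vectors with dot product [d] and cross
   product [c]; it is increasing in d / c. *)
Definition cos_of d c : R := d / Num.sqrt (d ^+ 2 + c ^+ 2).

Lemma cos_of_sqr d c : 0 < c -> cos_of d c ^+ 2 = d ^+ 2 / (d ^+ 2 + c ^+ 2).
Proof.
move=> c0; rewrite expr_div_n sqr_sqrtr // addr_ge0 ?sqr_ge0 //.
Qed.

Lemma cos_ofN d c : cos_of (- d) c = - cos_of d c.
Proof. by rewrite /cos_of sqrrN mulNr. Qed.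

Lemma sqrD_gt0 d c : 0 < c -> 0 < d ^+ 2 + c ^+ 2.
Proof. by move=> c0; rewrite ltr_wpDl ?sqr_ge0 // exprn_gt0. Qed.

Lemma cos_of_ge0 d c : 0 < c -> (0 <= cos_of d c) = (0 <= d).
Proof. by move=> c0; rewrite /cos_of pmulr_lge0 // invr_gt0 sqrtr_gt0 sqrD_gt0. Qed.

Lemma cos_of_itv d c : 0 < c -> -1 <= cos_of d c <= 1.
Proof.
move=> c0; rewrite -ler_norml le_sqr ?normr_ge0 ?ler01 //.
rewrite real_normK ?num_real // cos_of_sqr // expr1n ler_pdivrMr ?sqrD_gt0 //.
by rewrite mul1r lerDl sqr_ge0.
Qed.

Lemma le_cos_of d1 c1 d2 c2 : 0 < c1 -> 0 < c2 ->
  (cos_of d1 c1 <= cos_of d2 c2) = (d1 * c2 <= d2 * c1).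
Proof.
move=> c10 c20.
(* Squaring settles nonnegative dot products; different signs decide at once, and two negative ones
   are exchanged by negation. *)
have pos e1 e2 b1 b2 : 0 < b1 -> 0 < b2 -> 0 <= e1 -> 0 <= e2 ->
    (cos_of e1 b1 <= cos_of e2 b2) = (e1 * b2 <= e2 * b1).
  move=> b10 b20 e10 e20.
  rewrite le_sqr ?cos_of_ge0 //.
  rewrite !cos_of_sqr // ler_pdivrMr ?sqrD_gt0 // mulrAC ler_pdivlMr ?sqrD_gt0 //.
  rewrite [RHS]le_sqr ?mulr_ge0 ?(ltW b10) ?(ltW b20) //.
  by apply/idP/idP; lra.
case: (lerP 0 d1) => d10; case: (lerP 0 d2) => d20.
- exact: pos.
- transitivity false; last symmetry; apply/negbTE; rewrite -ltNge.
    by apply: (@lt_le_trans _ _ 0); rewrite ?cos_of_ge0 // ltNge cos_of_ge0 // -ltNge.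
  by apply: (@lt_le_trans _ _ 0); rewrite ?pmulr_llt0 // mulr_ge0 // ltW.
- transitivity true; last symmetry.
    by apply: ltW; apply: (@lt_le_trans _ _ 0); rewrite ?cos_of_ge0 // ltNge cos_of_ge0 // -ltNge.
  by apply: ltW; apply: (@lt_le_trans _ _ 0); rewrite ?pmulr_llt0 // mulr_ge0 // ltW.
rewrite -lerN2 -!cos_ofN pos ?oppr_ge0 ?(ltW d10) ?(ltW d20) //.
by rewrite !mulNr lerN2.
Qed.

Lemma le_acos (x y : R) : -1 <= x <= 1 -> -1 <= y <= 1 ->
  (acos x <= acos y) = (y <= x).
Proof.
move=> xI yI; rewrite !leNgt; congr (~~ _).
have acosI (z : R) : -1 <= z <= 1 -> acos z \in `[0, pi].
  by move=> zI; rewrite in_itv /= acos_ge0 ?acos_lepi.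
by rewrite -(ltr_cos (acosI _ yI) (acosI _ xI)) !acosK.
Qed.

(** By Lagrange's identity the squared product of the lengths is the dot product squared plus the
    cross product squared. *)
Lemma angle_cos_of p q r :
  angle p q r = acos (cos_of (dot (p - q) (r - q)) `|cross (p - q) (r - q)|).
Proof.
rewrite /angle /dist /cos_of -sqrtrM ?dot_ge0 // real_normK ?num_real //.
congr (acos (_ / Num.sqrt _)); rewrite /cross !dotE; ring.
Qed.

Lemma angle_mid p q r x :
  angle (2^-1 *: (x + p)) (2^-1 *: (x + q)) (2^-1 *: (x + r)) = angle p q r.
Proof.
rewrite /angle; congr acos.
have dE u v : 2^-1 *: (x + u) - 2^-1 *: (x + v) = 2^-1 *: (u - v) :> 'rV[R]_2.
  by apply/rV2P; rewrite !mxE; split; ring.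
have distE u v : dist (2^-1 *: (x + u)) (2^-1 *: (x + v)) = 2^-1 * dist u v.
  transitivity (Num.sqrt (2^-1 ^+ 2) * dist u v); last first.
    by rewrite sqrtr_sqr ger0_norm ?invr_ge0 ?ler0n.
  rewrite /dist dE !dotE !mxE -sqrtrM ?sqr_ge0 //; congr Num.sqrt; ring.
rewrite !distE !dE !dotE !mxE.
have -> : 2^-1 * dist p q * (2^-1 * dist r q) = 4^-1 * (dist p q * dist r q) by field.
by rewrite [(4^-1 * _)^-1]invfM invrK; set k := (dist _ _ * _)^-1; field.
Qed.

(** The sum is at most [pi] exactly when the two cotangents add up to a nonnegative number. The
    cross products have opposite signs, so by [pow_circle] that number has the sign of [pow C p]. *)
Lemma angle_sum_le_pi C a b p q : pow C a = 0 -> pow C b = 0 -> pow C q = 0 ->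
  cross (a - q) (b - q) * cross (a - p) (b - p) < 0 ->
  (angle a q b + angle a p b <= pi) = (0 <= pow C p).
Proof.
move=> Ca Cb Cq lt0; have := pow_circle p Ca Cb Cq; rewrite !angle_cos_of.
have nz : 0 < `|cross (a - q) (b - q)| /\ 0 < `|cross (a - p) (b - p)|.
  by rewrite !normr_gt0; split; apply: contraTneq lt0 => ->; rewrite ?mulr0 ?mul0r ltxx.
case: nz => q0 p0.
rewrite -lerBrDr -acosN ?cos_of_itv // le_acos ?cos_of_itv //; last first.
  by rewrite -cos_ofN cos_of_itv.
rewrite -cos_ofN le_cos_of //; move: q0 p0.
set X := cross (a - q) _ in lt0 *; set Y := cross (a - p) _ in lt0 *.
set dp := dot (a - p) _; set dq := dot (a - q) _ => q0 p0 e.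
case: (ltrgt0P X) lt0 q0 e => [X0 | X0 | ->]; rewrite ?mul0r ?ltxx // => lt0.
  have Y0 : Y < 0 by rewrite pmulr_rlt0 in lt0.
  rewrite (ltr0_norm Y0) => _ e.
  by rewrite -(pmulr_rge0 _ X0) -e; apply/idP/idP; lra.
have Y0 : 0 < Y by rewrite nmulr_rlt0 in lt0.
rewrite (gtr0_norm Y0) => _ e.
by rewrite -(nmulr_rle0 _ X0) -e; apply/idP/idP; lra.
Qed.

(** Here [p] and [q] are on the same side of ab, and [pow_circle] gives the sign of the difference
    of the cotangents. *)
Lemma angle_lt C a b p q : pow C a = 0 -> pow C b = 0 -> pow C q = 0 ->
  0 < cross (a - q) (b - q) * cross (a - p) (b - p) ->
  (angle a p b < angle a q b) = (0 < pow C p).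
Proof.
move=> Ca Cb Cq lt0; have := pow_circle p Ca Cb Cq; rewrite !angle_cos_of.
have nz : 0 < `|cross (a - q) (b - q)| /\ 0 < `|cross (a - p) (b - p)|.
  by rewrite !normr_gt0; split; apply: contraTneq lt0 => ->; rewrite ?mulr0 ?mul0r ltxx.
case: nz => q0 p0.
rewrite ltNge le_acos ?cos_of_itv // le_cos_of // -ltNge; move: q0 p0.
set X := cross (a - q) _ in lt0 *; set Y := cross (a - p) _ in lt0 *.
set dp := dot (a - p) _; set dq := dot (a - q) _ => q0 p0 e.
case: (ltrgt0P X) lt0 q0 e => [X0 | X0 | ->]; rewrite ?mul0r ?ltxx // => lt0.
  have Y0 : 0 < Y by rewrite pmulr_rgt0 in lt0.
  rewrite (gtr0_norm Y0) => _ e.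
  by rewrite -(pmulr_rgt0 _ X0) -e; apply/idP/idP; lra.
have Y0 : Y < 0 by rewrite nmulr_rgt0 in lt0.
rewrite (ltr0_norm Y0) => _ e.
by rewrite -(nmulr_rlt0 _ X0) -e; apply/idP/idP; lra.
Qed.

End Angles.

Lemma big_set2 (V : nmodType) (T : finType) (i j : T) (F : T -> V) :
  i != j -> \sum_(m in [set i; j]%SET) F m = F i + F j.
Proof. by move=> ij; rewrite big_setU1 ?big_set1 // inE. Qed.

Lemma uniq3 (T : eqType) (a b c : T) :
  uniq [:: a; b; c] = [&& a != b, a != c & b != c].
Proof. by rewrite /= !inE negb_or andbT -andbA. Qed.

Lemma uniq4 (T : eqType) (a b c d : T) :
  uniq [:: a; b; c; d] = [&& a != b, a != c, a != d, b != c, b != d & c != d].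
Proof. by rewrite /= !inE !negb_or andbT -!andbA. Qed.

Lemma exists_min (R : realType) (X : finType) (Q : X -> Prop) (g : X -> R) x0 :
  Q x0 -> exists2 x, Q x & forall y, Q y -> g x <= g y.
Proof.
move=> /asboolT Qx0.
case: (@arg_minP _ _ _ x0 (fun x => `[< Q x >]) g Qx0) => x /asboolP Qx h.
by exists x => // y /asboolT; apply: h.
Qed.

(** * Labelled triangles *)

Section Labels.
Variables (R : realType) (A : {fset 'rV[R]_2}).
Implicit Types (a b c d e p q y : A) (I J K L : {set A}) (s t u : {set {set A}}).

Definition black_triangle a b c : {set {set A}} :=
  [set [set a; b]; [set a; c]; [set b; c]]%SET.

Definition white_triangle y a b c : {set {set A}} :=
  [set [set y; a]; [set y; b]; [set y; c]]%SET.

Lemma black_rot a b c : black_triangle a b c = black_triangle b c a.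
Proof.
apply/setP => I; rewrite !inE (finset.setUC [set b]%SET [set a]%SET).
by rewrite (finset.setUC [set c]%SET [set a]%SET) orbC orbA.
Qed.

Lemma white_rot y a b c : white_triangle y a b c = white_triangle y b c a.
Proof. by apply/setP => I; rewrite !inE -orbA orbC. Qed.

Lemma mid2 a b : a != b -> mid [set a; b]%SET = 2^-1 *: (val a + val b).
Proof. by move=> ab; rewrite /mid big_set2. Qed.

Lemma card2_mem y I : #|I| = 2%N -> y \in I -> exists2 a, y != a & I = [set y; a]%SET.
Proof.
move=> /eqP /cards2P [a [b [ab ->]]]; rewrite !inE => /orP[] /eqP ->.
  by exists b.
by exists a; [rewrite eq_sym | rewrite finset.setUC].
Qed.

Lemma card_meet y a b : uniq [:: y; a; b] -> #|([set y; a] :&: [set y; b])%SET| = 1%N.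
Proof.
rewrite /= !inE negb_or => /and3P[/andP[ya yb] ab _].
suff -> : ([set y; a] :&: [set y; b])%SET = [set y]%SET by rewrite cards1.
apply/setP => p; rewrite !inE; have [-> //|/= _] := eqVneq p y.
by have [->|//] := eqVneq p a; rewrite (negPf ab).
Qed.

Lemma share_label I J : #|I| = 2%N -> #|J| = 2%N -> #|(I :&: J)%SET| = 1%N ->
  exists y a b, [/\ uniq [:: y; a; b], I = [set y; a]%SET & J = [set y; b]%SET].
Proof.
move=> cI cJ /eqP /cards1P [y e].
have /andP[yI yJ] : (y \in I) && (y \in J) by rewrite -finset.in_setI e inE.
have [a ya eI] := card2_mem cI yI; have [b yb eJ] := card2_mem cJ yJ.
exists y, a, b; split=> //; rewrite /= !inE negb_or ya yb /= andbT.
apply: contra_eq_neq (e) => ab; rewrite eI eJ ab finset.setIid.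
by apply/eqP => /setP /(_ b); rewrite !inE eqxx orbT eq_sym (negPf yb).
Qed.

(** A pair that avoids [y] has to meet the given pairs in [a] and in [b]; a pair through [y] brings
    in one new point. This is where the two colours come from. *)
Lemma meet_edge y a b K : uniq [:: y; a; b] -> #|K| = 2%N ->
  #|([set y; a] :&: K)%SET| = 1%N -> #|([set y; b] :&: K)%SET| = 1%N ->
  K = [set a; b]%SET \/ exists2 c, uniq [:: y; a; b; c] & K = [set y; c]%SET.
Proof.
rewrite /= !inE !negb_or => /and3P[/andP[ya yb] ab _] cK ma mb.
have [yK|yK] := boolP (y \in K).
  have [c yc eK] := card2_mem cK yK; right; exists c => //.
  rewrite /= !inE !negb_or ya yb yc ab /= andbT.
  apply/andP; split; [apply: contra_eq_neq ma | apply: contra_eq_neq mb] => ->.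
    by rewrite eK finset.setIid -eK cK.
  by rewrite eK finset.setIid -eK cK.
left; have inK x : #|([set y; x] :&: K)%SET| = 1%N -> x \in K.
  move=> /eqP /cards1P [z e]; have : z \in ([set y; x] :&: K)%SET by rewrite e inE.
  by rewrite !inE => /andP[/orP[] /eqP -> //]; rewrite (negPf yK).
have [z az eK] := card2_mem cK (inK _ ma).
move: (inK _ mb); rewrite eK !inE => /orP[/eqP e|/eqP -> //].
by rewrite e eqxx in ab.
Qed.

Lemma core_black a b c : uniq [:: a; b; c] ->
  (\bigcap_(I in black_triangle a b c) I)%SET = finset.set0.
Proof.
rewrite /= !inE negb_or => /and3P[/andP[ab ac] bc _].
rewrite /black_triangle !finset.bigcap_setU !big_set1; apply/setP => p; rewrite !inE.
have [->|pa] := eqVneq p a; first by rewrite (negPf ab) (negPf ac) !andbF.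
by have [->|pb] := eqVneq p b; rewrite ?(negPf bc) ?andbF.
Qed.

Lemma core_white y a b c : uniq [:: y; a; b; c] ->
  (\bigcap_(I in white_triangle y a b c) I)%SET = [set y]%SET.
Proof.
rewrite /= !inE !negb_or => /and4P[/and3P[ya yb yc] /andP[ab ac] bc _].
rewrite /white_triangle !finset.bigcap_setU !big_set1; apply/setP => p; rewrite !inE.
have [->|py] := eqVneq p y; first by [].
by have [->|pa] := eqVneq p a; rewrite /= ?(negPf ab).
Qed.

Lemma cover_black a b c : finset.cover (black_triangle a b c) = [set a; b; c]%SET.
Proof.
rewrite /finset.cover /black_triangle !finset.bigcup_setU !big_set1; apply/setP => p.
by rewrite !inE; case: (p == a); case: (p == b); case: (p == c).
Qed.

Lemma cover_white y a b c : finset.cover (white_triangle y a b c) = [set y; a; b; c]%SET.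
Proof.
rewrite /finset.cover /white_triangle !finset.bigcup_setU !big_set1; apply/setP => p.
by rewrite !inE; case: (p == y); case: (p == a); case: (p == b); case: (p == c).
Qed.

Lemma black_blackP a b c : uniq [:: a; b; c] ->
  black (black_triangle a b c) /\ ~~ white (black_triangle a b c).
Proof. by move=> u; rewrite /black /white core_black // eqxx cards0. Qed.

Lemma white_whiteP y a b c : uniq [:: y; a; b; c] ->
  white (white_triangle y a b c) /\ ~~ black (white_triangle y a b c).
Proof.
move=> u; rewrite /black /white core_white // cards1 eqxx; split=> //.
by apply/eqP => /setP /(_ y); rewrite !inE eqxx.
Qed.

Definition labelled t : Prop :=
  (exists a b c, uniq [:: a; b; c] /\ t = black_triangle a b c) \/
  (exists y a b c, uniq [:: y; a; b; c] /\ t = white_triangle y a b c).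

(* The core of a white triangle [ya][yb][yc] is {y}, that of a black one is
   empty; the rim is {a, b, c} in both cases. *)
Definition core t : {set A} := (\bigcap_(I in t) I)%SET.
Definition rim t : {set A} := (finset.cover t :\: core t)%SET.

Lemma rim_black a b c : uniq [:: a; b; c] -> rim (black_triangle a b c) = [set a; b; c]%SET.
Proof. by move=> u; rewrite /rim cover_black /core core_black // finset.setD0. Qed.

Lemma rim_white y a b c : uniq [:: y; a; b; c] ->
  rim (white_triangle y a b c) = [set a; b; c]%SET.
Proof.
move=> u; rewrite /rim cover_white /core core_white //; apply/setP => p.
move: u; rewrite /= !inE !negb_or => /and4P[/and3P[ya yb yc] _ _ _].
have [->|_ /=] := eqVneq p y; last by [].
by rewrite (negPf ya) (negPf yb) (negPf yc).
Qed.

Lemma labelled_card t I : labelled t -> I \in t -> #|I| = 2%N.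
Proof.
move=> [[a [b [c [u ->]]]]|[y [a [b [c [u ->]]]]]]; move: u.
  rewrite /= !inE negb_or -orbA => /and3P[/andP[ab ac] bc _] /or3P[] /eqP ->;
  by rewrite cards2 ?ab ?ac ?bc.
rewrite /= !inE !negb_or -orbA => /and4P[/and3P[ya yb yc] _ _ _] /or3P[] /eqP ->;
by rewrite cards2 ?ya ?yb ?yc.
Qed.

Hypothesis gen : generic A.

Lemma generic_cross a b c : uniq [:: a; b; c] -> cross (val b - val a) (val c - val a) != 0.
Proof.
move=> u; apply/noncollinearP; have [h _] := gen.
apply: (h [:: val a; val b; val c] _ _ (erefl _)); last first.
  by rewrite -(map_inj_uniq val_inj) in u.
by move=> x; rewrite !inE => /or3P[] /eqP ->; apply: valP.
Qed.

Lemma generic_pow C a b c d : uniq [:: a; b; c; d] ->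
  pow C (val a) = 0 -> pow C (val b) = 0 -> pow C (val c) = 0 -> pow C (val d) != 0.
Proof.
move=> u ha hb hc; apply/eqP => hd; have [_ h] := gen.
apply: (h [:: val a; val b; val c; val d] _ _ (erefl _)).
- by move=> x; rewrite !inE => /or4P[] /eqP ->; apply: valP.
- by rewrite -(map_inj_uniq val_inj) in u.
by apply: (@pow_cocircular _ C 0) => x; rewrite !inE => /or4P[] /eqP ->.
Qed.

(* The circle through the rim of [t] (meaningful for labelled [t] only). *)
Definition circ t : 'rV[R]_2 * R :=
  xget (0, 0) [set C | forall p, p \in rim t -> pow C (val p) = 0]%classic.

Local Notation pw t p := (pow (circ t) (val p)).

Lemma pow_rim t p : labelled t -> p \in rim t -> pw t p = 0.
Proof.
move=> lt; suff [C hC] : exists C, forall p, p \in rim t -> pow C (val p) = 0.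
  by move: p; rewrite /circ; case: xgetP => [C' _|/(_ C)] //; apply.
suff [a [b [c [u ->]]]] : exists a b c, uniq [:: a; b; c] /\ rim t = [set a; b; c]%SET.
  have [C [ha hb hc]] := circle_exists (generic_cross u).
  by exists C => x; rewrite !inE -orbA => /or3P[] /eqP ->.
case: lt => [[a [b [c [u ->]]]]|[y [a [b [c [u ->]]]]]]; exists a, b, c.
  by rewrite rim_black.
by rewrite rim_white //; split=> //; case/andP: u.
Qed.

(* For labelled [t], the height of the lift of [mid I] above the plane through
   the lifted vertices of [t]; hence it vanishes on [t], and the difference of
   two excesses is an affine function of [mid I]. *)
Definition excess t I : R := \sum_(p in I) pw t p - \sum_(p in core t) pw t p.

Lemma pow_black a b c : uniq [:: a; b; c] ->
  [/\ pw (black_triangle a b c) a = 0, pw (black_triangle a b c) b = 0 &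
      pw (black_triangle a b c) c = 0].
Proof.
move=> u; have lt : labelled (black_triangle a b c) by left; exists a, b, c.
by split; apply: pow_rim => //; rewrite rim_black // !inE eqxx ?orbT.
Qed.

Lemma pow_white y a b c : uniq [:: y; a; b; c] ->
  [/\ pw (white_triangle y a b c) a = 0, pw (white_triangle y a b c) b = 0 &
      pw (white_triangle y a b c) c = 0].
Proof.
move=> u; have lt : labelled (white_triangle y a b c) by right; exists y, a, b, c.
by split; apply: pow_rim => //; rewrite rim_white // !inE eqxx ?orbT.
Qed.

Lemma excess_black a b c p q : uniq [:: a; b; c] -> p != q ->
  excess (black_triangle a b c) [set p; q]%SET =
  pw (black_triangle a b c) p + pw (black_triangle a b c) q.
Proof.
move=> u pq; rewrite /excess /core core_black // big_set0 subr0.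
by rewrite big_set2.
Qed.

Lemma excess_white y a b c p q : uniq [:: y; a; b; c] -> p != q ->
  excess (white_triangle y a b c) [set p; q]%SET =
  pw (white_triangle y a b c) p + pw (white_triangle y a b c) q
  - pw (white_triangle y a b c) y.
Proof.
move=> u pq; rewrite /excess /core core_white // big_set1.
by rewrite big_set2.
Qed.

Lemma excess_self t I : labelled t -> I \in t -> excess t I = 0.
Proof.
case=> [[a [b [c [u ->]]]]|[y [a [b [c [u ->]]]]]].
  have [ha hb hc] := pow_black u; move: (u) => /=.
  rewrite !inE negb_or -orbA => /and3P[/andP[ab ac] bc _] /or3P[] /eqP ->;
  by rewrite excess_black // ?ha ?hb ?hc addr0.
have [ha hb hc] := pow_white u; move: (u) => /=.
rewrite !inE !negb_or -orbA => /and4P[/and3P[ya yb yc] _ _ _] /or3P[] /eqP ->;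
by rewrite excess_white // ?ha ?hb ?hc addr0 subrr.
Qed.

Lemma excess_affine t u : exists w k, forall I, #|I| = 2%N ->
  excess u I - excess t I = dot w (mid I) + k.
Proof.
(* The squares cancel in a difference of two powers. The factor 2 undoes the half in [mid], and in
   the constant it counts the two points of the label. *)
exists (2 *: ((circ t).1 - (circ u).1)).
exists (2 * ((circ t).2 - (circ u).2)
  - \sum_(p in core u) pw u p + \sum_(p in core t) pw t p).
move=> I /eqP /cards2P [p [q [pq ->]]].
rewrite /excess mid2 // !big_set2 //.
transitivity ((pw u p - pw t p) + (pw u q - pw t q)
  - \sum_(p in core u) pw u p + \sum_(p in core t) pw t p); first by ring.
have E z : pow (circ u) z - pow (circ t) z =
    dot ((circ t).1 - (circ u).1) z + ((circ t).2 - (circ u).2).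
  by rewrite /pow !dotE !mxE; ring.
by rewrite !E !dotE !mxE; field.
Qed.

(** The difference of the two excesses is affine and vanishes at the vertices of [t] other than [K],
    which [u] shares; so only the coordinate at [K] contributes. *)
Lemma excess_weights t u K I l : labelled t -> labelled u -> K \in t -> t :\ K \subset u ->
  #|I| = 2%N -> weights (@mid R A) t l (mid I) ->
  excess u I = excess t I + l K * excess u K.
Proof.
move=> lt lu tK tu cI wl; have [w [k h]] := excess_affine t u.
apply/eqP; rewrite addrC -subr_eq h // (weights_affine w k wl) (bigD1 K) //=.
rewrite -h ?(labelled_card lt) // (excess_self lt tK) subr0 big1 ?addr0 // => J.
move=> /andP[tJ JK]; rewrite -h ?(labelled_card lt) // !excess_self ?subrr ?mulr0 //.
by apply: (fintype.subsetP tu); rewrite !inE JK.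
Qed.

(** The analogue of [excess_weights] for circles: [b] and [c] lie on the radical axis of [C] and
    [C']. *)
Lemma pow_weights C C' a b c x l : uniq [:: a; b; c] ->
  weights (fun p : A => val p) [set a; b; c]%SET l x ->
  pow C (val b) = pow C' (val b) -> pow C (val c) = pow C' (val c) ->
  pow C x = pow C' x + l a * (pow C (val a) - pow C' (val a)).
Proof.
move=> u wl hb hc.
have E z : pow C z - pow C' z = dot (C'.1 - C.1) z + (C'.2 - C.2).
  by rewrite /pow !dotE !mxE; ring.
apply/eqP; rewrite addrC -subr_eq (E x) (weights_affine _ _ wl) big_set3 // -!E.
by rewrite hb hc !subrr !mulr0 !addr0.
Qed.

End Labels.

Lemma set3_of_card (T : finType) (t : {set T}) i j : #|t| = 3%N ->
  i \in t -> j \in t -> i != j ->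
  exists2 k, uniq [:: i; j; k] & t = [set i; j; k]%SET.
Proof.
move=> ct ti tj ij.
have c1 : #|(t :\ i :\ j)%SET| = 1%N.
  have tij : j \in (t :\ i)%SET by rewrite !inE eq_sym ij.
  have := cardsD1 i t; rewrite ct ti add1n => -[c2].
  by have := cardsD1 j (t :\ i)%SET; rewrite tij -c2 add1n => -[].
move/eqP: c1 => /cards1P [k e].
have : k \in (t :\ i :\ j)%SET by rewrite e inE.
rewrite !inE => /and3P[kj ki tk].
exists k; first by rewrite /= !inE negb_or ij eq_sym ki eq_sym kj.
apply/setP => m; rewrite !inE -orbA.
have [-> //|mi] := eqVneq m i; have [-> //|mj] := eqVneq m j.
by have /setP /(_ m) := e; rewrite !inE mi mj.
Qed.

(** * Adjacency in a hypertriangulation *)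

Section Hypertriangulation.
Variables (R : realType) (A : {fset 'rV[R]_2}) (P : {set {set {set A}}}).
Implicit Types (a b c d e p y : A) (I J K L : {set A}) (s t u : {set {set A}}).
Hypothesis gen : generic A.
Hypothesis hP : is_hypertriangulation P.

Local Notation W := (weights (@mid R A)).

Lemma cover_mem t I : t \in P -> I \in t -> I \in finset.cover P.
Proof. by move=> tP tI; apply/bigcupP; exists t. Qed.

Lemma label_card I : I \in finset.cover P -> #|I| = 2%N.
Proof. by case: hP => h _ _ _; apply: h. Qed.

Lemma midpoints_mid I : #|I| = 2%N -> midpoints A (mid I).
Proof. by move=> cI; exists I. Qed.

Lemma triangle_vertices t : t \in P ->
  exists I J K, [/\ uniq [:: I; J; K], t = [set I; J; K]%SET &
    cross (mid J - mid I) (mid K - mid I) != 0].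
Proof.
move=> tP; case: hP => _ inj [tri _ _] _.
have [|[a [b [c [e /noncollinearP nz]]]] _] := tri (corners t); first by exists t.
have vert x : corners t x -> exists2 I, I \in t & mid I = x by case=> I; exists I.
have [I tI eI] : exists2 I, I \in t & mid I = a by apply: vert; rewrite e; left; left.
have [J tJ eJ] : exists2 I, I \in t & mid I = b by apply: vert; rewrite e; left; right.
have [K tK eK] : exists2 I, I \in t & mid I = c by apply: vert; rewrite e; right.
exists I, J, K; rewrite eI eJ eK; split=> //.
  rewrite /= !inE negb_or andbT -andbA; apply/and3P; split; apply: contraNneq nz => E.
  - by rewrite -eI -eJ E subrr /cross !mxE !mul0r subrr.
  - by rewrite -eI -eK E subrr /cross !mxE !mulr0 subrr.
  - by rewrite -eK -eJ E; apply/eqP; rewrite /cross; ring.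
apply/setP => M; rewrite !inE -orbA; apply/idP/idP => [tM|/or3P[] /eqP -> //].
have : corners t (mid M) by exists M.
rewrite e => -[[|]|] /=; rewrite -?eI -?eJ -?eK => E; apply/or3P.
- by constructor 1; apply/eqP; apply: inj E; apply: cover_mem tP _.
- by constructor 2; apply/eqP; apply: inj E; apply: cover_mem tP _.
- by constructor 3; apply/eqP; apply: inj E; apply: cover_mem tP _.
Qed.

Lemma triangle_card t : t \in P -> #|t| = 3%N.
Proof.
move=> /triangle_vertices [I [J [K [u -> _]]]].
have /card_uniqP := u; rewrite /= => <-; apply: eq_card => M.
by rewrite !inE -orbA.
Qed.

Lemma triangle_simplex t : t \in P -> simplex (@mid R A) t.
Proof. by move=> /triangle_vertices [I [J [K [u -> nz]]]]; apply: simplex_triangle. Qed.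

Lemma triangle_meet t I J : t \in P -> I \in t -> J \in t -> I != J ->
  #|(I :&: J)%SET| = 1%N.
Proof. by case: hP => _ _ _ h; apply: h. Qed.

Lemma edge_cases t y b c : t \in P -> uniq [:: y; b; c] ->
  [set y; b]%SET \in t -> [set y; c]%SET \in t ->
  t = black_triangle y b c \/
  exists2 e, uniq [:: y; b; c; e] & t = white_triangle y b c e.
Proof.
move=> tP u tb tc.
have bc : [set y; b]%SET != [set y; c]%SET.
  apply: contraTneq u => /setP /(_ b); rewrite /= !inE eqxx orbT => /esym.
  by case/orP => /eqP ->; rewrite eqxx ?andbF.
have [K uK et] := set3_of_card (triangle_card tP) tb tc bc.
have tK : K \in t by rewrite et !inE eqxx !orbT.
move: uK; rewrite /= !inE negb_or => /and3P[/andP[_ bK] cK _].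
have [eK|[e ue eK]] := meet_edge u (label_card (cover_mem tP tK))
  (triangle_meet tP tb tK bK) (triangle_meet tP tc tK cK).
  by left; rewrite et eK.
by right; exists e => //; rewrite et eK.
Qed.

Lemma triangle_labelled t : t \in P -> labelled t.
Proof.
move=> tP; have [I [J [K [u et _]]]] := triangle_vertices tP.
move: u; rewrite /= !inE negb_or => /and3P[/andP[IJ _] _ _].
have tI : I \in t by rewrite et !inE eqxx.
have tJ : J \in t by rewrite et !inE eqxx !orbT.
have [y [a [b [uy eI eJ]]]] := share_label (label_card (cover_mem tP tI))
  (label_card (cover_mem tP tJ)) (triangle_meet tP tI tJ IJ).
rewrite eI in tI; rewrite eJ in tJ.
have [->|[c uc ->]] := edge_cases tP uy tI tJ; first by left; exists y, a, b.
by right; exists y, a, b, c.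
Qed.

Lemma hull_weights t x : conv_hull (corners t) x <->
  exists2 l, W t l x & forall I, I \in t -> 0 <= l I.
Proof. exact: conv_hull_weights. Qed.

(** Injectivity of [mid] on the labels in use turns common corners into common labels. *)
Lemma hull_cap s t x : s \in P -> t \in P ->
  conv_hull (corners s) x -> conv_hull (corners t) x ->
  conv_hull (corners (s :&: t)%SET) x.
Proof.
move=> sP tP sx tx; case: hP => _ inj [_ _ cap] _.
have : (conv_hull (corners s) `&` conv_hull (corners t))%classic x by [].
rewrite cap; [|by exists s|by exists t].
suff -> : (corners s `&` corners t = corners (s :&: t)%SET)%classic by [].
rewrite eqEsubset; split=> z /=.
  move=> [[I sI <-] [J tJ E]]; exists I => //=.
  by rewrite inE sI -(inj _ _ (cover_mem tP tJ) (cover_mem sP sI) E).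
by move=> [I /= ]; rewrite inE => /andP[sI tI] <-; split; exists I.
Qed.

(** The point lies in the common face, and uniqueness of its coordinates in [s] kills those at the
    vertices outside [t]. In this form the edge-to-edge condition is used below. *)
Lemma weights_cap s t x l : s \in P -> t \in P -> W s l x ->
  conv_hull (corners s) x -> conv_hull (corners t) x ->
  forall I, I \in s -> l I != 0 -> I \in t.
Proof.
move=> sP tP wl sx tx I sI; apply: contraR => It.
have /hull_weights [l' wl' _] := hull_cap sP tP sx tx.
have := weights_sub (finset.subsetIl s t) wl' => wl''.
rewrite ((triangle_simplex sP).1 _ _ _ wl wl'' I sI).
by rewrite finset.in_setI (negPf It) andbF.
Qed.

Lemma vertex_mem t I : t \in P -> I \in finset.cover P ->
  conv_hull (corners t) (mid I) -> I \in t.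
Proof.
move=> tP /bigcupP [s sP sI] tI.
apply: (weights_cap sP tP (weights_vertex _ sI)) => //.
  by apply: sub_conv_hull; exists I.
by rewrite eqxx oner_neq0.
Qed.

Lemma hull_cover x : conv_hull (midpoints A) x ->
  exists2 t, t \in P & conv_hull (corners t) x.
Proof.
case: hP => _ _ [_ <- _] _ [_ [t tP <-] tx]; by exists t.
Qed.

Lemma corners_hull t x : t \in P -> conv_hull (corners t) x ->
  conv_hull (midpoints A) x.
Proof. by case: hP => _ _ [_ <- _] _ tP tx; exists (corners t) => //; exists t. Qed.

(** Closedness of a triangle along a segment: some coordinate is negative at [x], and it remains so
    for a while on the way to [z]. The denominator of the bound exceeds the rate at which this
    coordinate can grow. *)
Lemma hull_avoid t x z : t \in P -> ~ conv_hull (corners t) x ->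
  exists2 e : R, 0 < e & forall r, 0 < r < e ->
    ~ conv_hull (corners t) (r *: z + (1 - r) *: x).
Proof.
move=> tP tx; have [uq ex] := triangle_simplex tP.
have [l wl] := ex x; have [m wm] := ex z.
have [I tI lI] : exists2 I, I \in t & l I < 0.
  apply/not_exists2P => h; apply: tx; apply/hull_weights; exists l => // I tI.
  by rewrite leNgt; apply/negP; have [] := h I.
exists (- l I / (1 + `|m I| - l I)).
  by rewrite divr_gt0 ?oppr_gt0 // ltr_wpDl ?oppr_gt0 // addr_ge0.
move=> r /andP[r0]; rewrite ltr_pdivlMr; last by rewrite ltr_wpDl ?oppr_gt0 // addr_ge0.
move=> re /hull_weights [k wk k0].
have := k0 I tI; rewrite (uq _ _ _ wk (weights_conv r wm wl) I tI).
apply/negP; rewrite -ltNge; have := ler_norm (m I); nra.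
Qed.

(* The triangle met first on the way from the midpoint of the edge opposite [K]
   to [q]. *)
Lemma neighbour t K (q : 'rV[R]_2) l : t \in P -> K \in t -> conv_hull (midpoints A) q ->
  W t l q -> l K < 0 ->
  exists u, [/\ u \in P, u != t & (t :\ K)%SET \subset u].
Proof.
move=> tP tK hq wl lK; have ct := triangle_card tP.
pose m I : R := if I == K then 0 else 2^-1.
pose x := \sum_(I in t) m I *: mid I.
have wm : W t m x.
  split=> //; rewrite (bigD1 K) //= {1}/m eqxx add0r.
  rewrite (eq_bigr (fun=> 2^-1)) => [|I /andP[_ /negPf IK]]; last by rewrite /m IK.
  rewrite (eq_bigl (mem (t :\ K)%SET)) => [|I]; last by rewrite !inE andbC.
  have cK : #|(t :\ K)%SET| = 2%N.
    by move: (cardsD1 K t); rewrite ct tK add1n => -[].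
  by rewrite sumr_const cK -mulr_natr; field.
have tx : conv_hull (corners t) x.
  by apply/hull_weights; exists m => // I _; rewrite /m; case: ifP => // _; rewrite invr_ge0.
have [e e0 he] : exists2 e : R, 0 < e & forall u, u \in P -> ~ conv_hull (corners u) x ->
    forall r, 0 < r < e -> ~ conv_hull (corners u) (r *: q + (1 - r) *: x).
  suff [e e0 he] : exists2 e : R, 0 < e & forall u, u \in enum P -> ~ conv_hull (corners u) x ->
    forall r, 0 < r < e -> ~ conv_hull (corners u) (r *: q + (1 - r) *: x).
    by exists e => // u uP; apply: he; rewrite mem_enum.
  have : {subset enum P <= P} by move=> u; rewrite mem_enum.
  elim: (enum P) => [|v r IH] sub; first by exists 1.
  have [|e e0 he] := IH; first by move=> w wr; apply: sub; rewrite inE wr orbT.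
  have vP : v \in P by apply: sub; rewrite mem_head.
  have [vx|vx] := pselect (conv_hull (corners v) x).
    by exists e => // w; rewrite inE => /predU1P[-> //|]; apply: he.
  have [e' e'0 he'] := hull_avoid q vP vx.
  exists (Num.min e e'); first by rewrite lt_min e0 e'0.
  move=> w; rewrite inE => /predU1P[-> _ k|wr wx k] /andP[k0]; rewrite lt_min => /andP[ke ke'].
    by apply: he'; rewrite k0.
  by apply: he => //; rewrite k0.
(* The bound [e] serves all triangles that miss [x], so whichever triangle covers the point at
   parameter [r] contains [x] and with it the whole edge. It is not [t], where the coordinate at [K]
   would be [r * l K < 0]. *)
pose r := Num.min (e / 2) 1.
have r0 : 0 < r by rewrite lt_min divr_gt0 ?ltr01.
have r1 : r <= 1 by rewrite ge_min lexx orbT.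
have re : r < e by rewrite gt_min ltr_pdivrMr // mulr_natr mulr2n ltrDl e0.
have [|u uP ux] := @hull_cover (r *: q + (1 - r) *: x).
  by apply: conv_hull_convex; rewrite ?(ltW r0) //; apply: corners_hull tx.
exists u; split=> //.
  apply/eqP => ut; rewrite ut in ux; move/hull_weights: ux => [k wk k0].
  have := k0 K tK; rewrite ((triangle_simplex tP).1 _ _ _ wk (weights_conv r wl wm) K tK).
  by rewrite /m eqxx mulr0 addr0 leNgt pmulr_rlt0 ?lK.
have ux0 : conv_hull (corners u) x.
  by apply: contrapT => nx; apply: (he u uP nx _ _ ux); rewrite r0.
apply/fintype.subsetP => I; rewrite !inE => /andP[IK tI].
by apply: (weights_cap tP uP wm) => //; rewrite /m (negPf IK) invr_eq0.
Qed.

End Hypertriangulation.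

(** The medial triangle is a half-turned copy of y a b at half the size, with the midpoint of ab in
    the place of [y]. *)
Lemma angle_medial (R : realType) (y a b : 'rV[R]_2) :
  angle (2^-1 *: (y + a)) (2^-1 *: (a + b)) (2^-1 *: (y + b)) = angle a y b.
Proof.
have -> : a + b = y + (a + b - y) by rewrite [RHS]addrC subrK.
rewrite angle_mid !angle_cos_of; congr (acos (cos_of _ _)).
  by rewrite !dotE !mxE; ring.
by rewrite -normrN; congr `|_|; rewrite /cross !mxE; ring.
Qed.

(** * Local angles and local convexity *)

Section LocalAngles.
Variables (R : realType) (A : {fset 'rV[R]_2}) (P : {set {set {set A}}}).
Implicit Types (a b c d e p y : A) (I J K L : {set A}) (s t u : {set {set A}}).
Hypothesis gen : generic A.
Hypothesis hP : is_hypertriangulation P.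

Local Notation W := (weights (@mid R A)).

Lemma share_edge_sym s t I J K L : share_edge s t I J K L -> share_edge t s I J L K.
Proof. by case=> st *; split=> // ts; apply: st. Qed.

(* Otherwise the two triangles overlap near the midpoint of the edge. *)
Lemma share_edge_opposite s t I J K L l : s \in P -> t \in P ->
  share_edge s t I J K L -> W s l (mid L) -> l K < 0.
Proof.
move=> sP tP [st us ut es et] wl.
have KL : K != L by apply: contra_notN st => /eqP KL; rewrite es et KL.
have tK : K \notin t.
  apply/negP; rewrite et !inE -orbA => /or3P[] /eqP E.
  - by move: us; rewrite E /= !inE eqxx orbT.
  - by move: us; rewrite E /= !inE eqxx andbF.
  by move: KL; rewrite E eqxx.
have tL : L \in t by rewrite et !inE eqxx orbT.
have sK : K \in s by rewrite es !inE eqxx orbT.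
have [/negPf IK /negPf JK] : I != K /\ J != K.
  by move: us; rewrite /= !inE negb_or => /and3P[/andP[_ ->] ->].
have [/negPf IL /negPf JL] : I != L /\ J != L.
  by move: ut; rewrite /= !inE negb_or => /and3P[/andP[_ ->] ->].
(* A zero coordinate would put the apex of [t] on the line of its own edge; a positive one makes the
   triangles overlap. *)
rewrite ltNge le_eqVlt; apply/negP => /orP[/eqP lK0|lK].
  have wl' : W t (fun M => if M == L then 0 else l M) (mid L).
    case: wl; rewrite es et => s1 s2; split.
      by rewrite big_set3 // IL JL eqxx -s1 big_set3 // -lK0.
    by rewrite big_set3 // IL JL eqxx scale0r -s2 big_set3 // -lK0 scale0r.
  have := (triangle_simplex hP tP).1 _ _ _ wl' (weights_vertex _ tL) _ tL.
  by rewrite /= eqxx => /esym/eqP; rewrite oner_eq0.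
pose x : 'rV[R]_2 := 2^-1 *: mid I + 2^-1 *: mid J.
have ws : W s (fun M => if M == K then 0 else 2^-1) x.
  rewrite es; split; rewrite big_set3 // IK JK eqxx ?scale0r addr0 //.
  by field.
have wt : W t (fun M => if M == L then 0 else 2^-1) x.
  rewrite et; split; rewrite big_set3 // IL JL eqxx ?scale0r addr0 //.
  by field.
(* So short a step from [x] towards [mid L] that the coordinates at [I] and [J], which start from
   one half, stay nonnegative. The coordinate at [K] becomes positive, although [K] is not in
   [t]. *)
pose e : R := (2 * (1 + `|l I| + `|l J|))^-1.
have d0 : 0 < 2 * (1 + `|l I| + `|l J|) by have := normr_ge0 (l I); have := normr_ge0 (l J); lra.
have e0 : 0 < e by rewrite invr_gt0.
have e1 : e * (2 * (1 + `|l I| + `|l J|)) = 1 by rewrite mulVf // gt_eqF.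
have eI0 : 0 <= e * `|l I| by rewrite mulr_ge0 ?normr_ge0 // ltW.
have eJ0 : 0 <= e * `|l J| by rewrite mulr_ge0 ?normr_ge0 // ltW.
have e2 : 0 <= 1 - e by lra.
have eI : 0 <= e * l I + (1 - e) * 2^-1.
  have : - (e * `|l I|) <= e * l I by rewrite -mulrN ler_pM2l // lerNnormlW.
  by lra.
have eJ : 0 <= e * l J + (1 - e) * 2^-1.
  have : - (e * `|l J|) <= e * l J by rewrite -mulrN ler_pM2l // lerNnormlW.
  by lra.
have := weights_conv e wl ws; set z := e *: _ + _ => wz.
have hs : conv_hull (corners s) z.
  apply/hull_weights; eexists; first exact: wz.
  move=> M; rewrite es !inE -orbA => /or3P[] /eqP ->; rewrite ?IK ?JK ?eqxx //.
  by rewrite mulr0 addr0 mulr_ge0 // ltW.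
have ht : conv_hull (corners t) z.
  apply/hull_weights; eexists; first exact: weights_conv e (weights_vertex _ tL) wt.
  move=> M _; rewrite addr_ge0 // mulr_ge0 ?ler0n ?(ltW e0) //.
  by case: ifP => _ //; rewrite invr_ge0.
have := weights_cap hP sP tP wz hs ht sK.
rewrite eqxx mulr0 addr0 (negPf tK) => h; suff : false by [].
by apply: h; rewrite mulf_neq0 ?lt0r_neq0.
Qed.

(** A barycentric coordinate is a ratio of signed areas. *)
Lemma cross_weights (p q r x : 'rV[R]_2) (i j k : R) : i + j + k = 1 ->
  i *: p + j *: q + k *: r = x ->
  cross (p - x) (q - x) = k * cross (p - r) (q - r).
Proof.
move=> e <-; have -> : i = 1 - j - k by rewrite -e; ring.
by rewrite /cross !mxE; ring.
Qed.

Lemma share_edge_cross s t I J K L : s \in P -> t \in P -> share_edge s t I J K L ->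
  cross (mid I - mid K) (mid J - mid K) != 0 ->
  cross (mid I - mid K) (mid J - mid K) * cross (mid I - mid L) (mid J - mid L) < 0.
Proof.
move=> sP tP sh nz; have [st us ut es et] := sh.
have [l wl] := (triangle_simplex hP sP).2 (mid L).
have lK := share_edge_opposite sP tP sh wl.
case: wl; rewrite es !big_set3 // => s1 s2.
rewrite (cross_weights s1 s2) mulrCA -expr2 nmulr_rlt0 //.
by rewrite lt_neqAle sqr_ge0 andbT eq_sym sqrf_eq0.
Qed.

(** A black triangle is determined by any one of its edges: only [ab] avoids y and meets both [ya]
    and [yb]. Two distinct triangles on an edge include at most one black, which leaves three
    cases. *)
Lemma share_edge_cases s t I J K L : s \in P -> t \in P -> share_edge s t I J K L ->
  exists y a b, [/\ I = [set y; a]%SET, J = [set y; b]%SET, uniq [:: y; a; b] &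
    [\/ exists c d, [/\ K = [set y; c]%SET /\ L = [set y; d]%SET, c != d,
           uniq [:: y; a; b; c] /\ uniq [:: y; a; b; d],
           s = white_triangle y a b c & t = white_triangle y a b d],
        exists c, [/\ K = [set a; b]%SET /\ L = [set y; c]%SET, uniq [:: y; a; b; c],
           s = black_triangle y a b & t = white_triangle y a b c] |
        exists c, [/\ K = [set y; c]%SET /\ L = [set a; b]%SET, uniq [:: y; a; b; c],
           s = white_triangle y a b c & t = black_triangle y a b]]].
Proof.
move=> sP tP [st us ut es et].
have sI : I \in s by rewrite es !inE eqxx.
have sJ : J \in s by rewrite es !inE eqxx orbT.
have sK : K \in s by rewrite es !inE eqxx orbT.
have tI : I \in t by rewrite et !inE eqxx.
have tJ : J \in t by rewrite et !inE eqxx orbT.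
have tL : L \in t by rewrite et !inE eqxx orbT.
move: us; rewrite uniq3 => /and3P[IJ IK JK].
move: ut; rewrite uniq3 => /and3P[_ IL JL].
have [y [a [b [u eI eJ]]]] := share_label (label_card hP (cover_mem sP sI))
  (label_card hP (cover_mem sP sJ)) (triangle_meet hP sP sI sJ IJ).
exists y, a, b; split=> //.
have meet u' M : u' \in P -> I \in u' -> J \in u' -> M \in u' -> I != M -> J != M ->
    M = [set a; b]%SET \/ exists2 c, uniq [:: y; a; b; c] & M = [set y; c]%SET.
  move=> uP uI uJ uM IM JM; apply: (meet_edge u (label_card hP (cover_mem uP uM))).
    by rewrite -eI; apply: (triangle_meet hP uP).
  by rewrite -eJ; apply: (triangle_meet hP uP).
have [eK|[c uc eK]] := meet _ _ sP sI sJ sK IK JK;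
have [eL|[d ud eL]] := meet _ _ tP tI tJ tL IL JL.
- by case: st; rewrite es et eK eL.
- constructor 2; exists d; split; [by []| by []| by rewrite es eI eJ eK |].
  by rewrite et eI eJ eL.
- constructor 3; exists c; split; [by []| by []| by rewrite es eI eJ eK |].
  by rewrite et eI eJ eL.
constructor 1; exists c, d; split; first by [].
- by apply: contra_notN st => /eqP cd; rewrite es et eK eL cd.
- by [].
- by rewrite es eI eJ eK.
by rewrite et eI eJ eL.
Qed.

Lemma cross_mid (x p q r : 'rV[R]_2) :
  cross (2^-1 *: (x + p) - 2^-1 *: (x + r)) (2^-1 *: (x + q) - 2^-1 *: (x + r)) =
  4^-1 * cross (p - r) (q - r).
Proof. by rewrite /cross !mxE; field. Qed.

Lemma generic_cross_apex a b c : uniq [:: a; b; c] -> cross (val a - val c) (val b - val c) != 0.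
Proof.
move=> u; have /generic_cross : uniq [:: c; a; b] by rewrite -(rot_uniq 1).
exact.
Qed.

(** The contribution of [y] cancels in the excess, which becomes the power of [d]. Genericity
    excludes power zero, so the weak angle bound matches a strict inequality. *)
Lemma angle_ww s t y a b c d : s \in P -> t \in P ->
  share_edge s t [set y; a]%SET [set y; b]%SET [set y; c]%SET [set y; d]%SET ->
  uniq [:: y; a; b; c] -> uniq [:: y; a; b; d] -> c != d ->
  s = white_triangle y a b c -> t = white_triangle y a b d ->
  (angle (mid [set y; a]%SET) (mid [set y; c]%SET) (mid [set y; b]%SET)
   + angle (mid [set y; a]%SET) (mid [set y; d]%SET) (mid [set y; b]%SET) <= pi)
  = (0 < excess s [set y; d]%SET).
Proof.
move=> sP tP sh uc ud cd es et; have [pa pb pc] := pow_white gen uc.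
have := uc; rewrite uniq4 => /and5P[ya yb yc ab /andP[ac bc]].
have := ud; rewrite uniq4 => /and5P[_ _ yd _ /andP[ad bd]].
have := share_edge_cross sP tP sh; rewrite !mid2 // !cross_mid !angle_mid => cr.
rewrite es excess_white // addrAC subrr add0r.
rewrite (angle_sum_le_pi pa pb pc); last first.
  have nz : cross (val a - val c) (val b - val c) != 0.
    by apply: generic_cross_apex; case/andP: uc.
  have := cr (mulf_neq0 _ nz); rewrite invr_eq0 pnatr_eq0 => /(_ isT).
  by rewrite mulrACA pmulr_rlt0 // mulr_gt0 ?invr_gt0.
have ux : uniq [:: a; b; c; d] by rewrite uniq4 ab ac ad bc bd cd.
by rewrite [RHS]lt_def (generic_pow gen ux pa pb pc).
Qed.

(** The black triangle is half-turned against y a b. Lying on opposite sides of the shared edge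
    therefore puts [c] and [y] on the same side of ab, and [angle_lt] replaces [angle_sum_le_pi]. *)
Lemma angle_bw s t y a b c : s \in P -> t \in P ->
  share_edge s t [set y; a]%SET [set y; b]%SET [set a; b]%SET [set y; c]%SET ->
  uniq [:: y; a; b; c] ->
  s = black_triangle y a b -> t = white_triangle y a b c ->
  (angle (mid [set y; a]%SET) (mid [set y; c]%SET) (mid [set y; b]%SET)
   < angle (mid [set y; a]%SET) (mid [set a; b]%SET) (mid [set y; b]%SET))
  = (0 < excess s [set y; c]%SET).
Proof.
move=> sP tP sh uc es et.
have u : uniq [:: y; a; b] by move: uc; rewrite -(rot_uniq 3) /= => /andP[].
have [py pa pb] := pow_black gen u.
have := uc; rewrite uniq4 => /and5P[ya yb yc ab /andP[ac bc]].
have := share_edge_cross sP tP sh; rewrite !mid2 // angle_mid angle_medial => cr.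
rewrite es excess_black // py add0r; apply: (angle_lt pa pb py).
have nz : cross (val a - val y) (val b - val y) != 0.
  by apply: generic_cross_apex; rewrite -(rot_uniq 2).
move: cr; rewrite cross_mid.
have -> : cross (2^-1 *: (val y + val a) - 2^-1 *: (val a + val b))
  (2^-1 *: (val y + val b) - 2^-1 *: (val a + val b)) =
  - 4^-1 * cross (val a - val y) (val b - val y).
  by rewrite /cross !mxE; field.
rewrite mulf_neq0 ?oppr_eq0 ?invr_eq0 ?pnatr_eq0 // => /(_ isT).
by rewrite mulrACA nmulr_rlt0 // mulNr oppr_lt0 mulr_gt0 ?invr_gt0.
Qed.

(** Convexity along an edge can be read from either side. This lets the black triangle come first,
    as in condition (bw). *)
Lemma excess_opposite s t I J K L : s \in P -> t \in P -> share_edge s t I J K L ->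
  (0 < excess s L) = (0 < excess t K).
Proof.
move=> sP tP sh; have [l wl] := (triangle_simplex hP sP).2 (mid L).
have lK := share_edge_opposite sP tP sh wl.
have [st us ut es et] := sh.
have sK : K \in s by rewrite es !inE eqxx orbT.
have tL : L \in t by rewrite et !inE eqxx orbT.
have lt := triangle_labelled hP tP.
have st' : s :\ K \subset t.
  apply/fintype.subsetP => M; rewrite es et !inE -orbA => /andP[/negPf ->].
  by rewrite orbF => ->.
have := excess_weights gen (triangle_labelled hP sP) lt sK st' (labelled_card lt tL) wl.
rewrite (excess_self gen lt tL) => /esym/eqP; rewrite addr_eq0 => /eqP ->.
by rewrite -mulNr pmulr_rgt0 // oppr_gt0.
Qed.

Lemma local_angle_excess :
  local_angle_property P <->
  forall s t I J K L, s \in P -> t \in P -> share_edge s t I J K L -> 0 < excess s L.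
Proof.
split=> h s t I J K L sP tP sh; have := h _ _ _ _ _ _ sP tP sh.
  have [y [a [b [eI eJ u [[c [d [[eK eL] cd [uc ud] es et]]]|[c [[eK eL] uc es et]]|
    [c [[eK eL] uc es et]]]]]]] := share_edge_cases sP tP sh; subst I J K L.
  - move=> [h1 _ _]; rewrite -(angle_ww sP tP sh uc ud cd es et); apply: h1.
      by rewrite es; case: (white_whiteP uc).
    by rewrite et; case: (white_whiteP ud).
  - move=> [_ _ h1]; rewrite -(angle_bw sP tP sh uc es et); apply: h1.
      by rewrite es; case: (black_blackP u).
    by rewrite et; case: (white_whiteP uc).
  - move=> _; have sh' := share_edge_sym sh; have [_ _ h1] := h _ _ _ _ _ _ tP sP sh'.
    rewrite (excess_opposite sP tP sh) -(angle_bw tP sP sh' uc et es); apply: h1.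
      by rewrite et; case: (black_blackP u).
    by rewrite es; case: (white_whiteP uc).
have [y [a [b [eI eJ u [[c [d [[eK eL] cd [uc ud] es et]]]|[c [[eK eL] uc es et]]|
    [c [[eK eL] uc es et]]]]]]] := share_edge_cases sP tP sh; subst I J K L => e0; cbv zeta.
- rewrite (angle_ww sP tP sh uc ud cd es et); split=> // bs.
    by rewrite es (negPf (white_whiteP uc).2) in bs.
  by rewrite es (negPf (white_whiteP uc).2) in bs.
- rewrite (angle_bw sP tP sh uc es et); split=> // bs.
    by rewrite es (negPf (black_blackP u).2) in bs.
  by rewrite et (negPf (white_whiteP uc).2).
- split=> bs.
  + by rewrite et (negPf (black_blackP u).2).
  + by rewrite es (negPf (white_whiteP uc).2) in bs.
  by rewrite es (negPf (white_whiteP uc).2) in bs.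
Qed.

End LocalAngles.

(** * Subdivision at an interior vertex *)

Section Subdivision.
Variables (R : realType) (A : {fset 'rV[R]_2}) (P : {set {set {set A}}}).
Implicit Types (I J K L v w : {set A}) (s t u : {set {set A}}).
Hypothesis hP : is_hypertriangulation P.

Local Notation W := (weights (@mid R A)).

Variables (t : {set {set A}}) (D : {set A}) (sg : {set A} -> R).
Hypotheses (tP : t \in P) (cD : #|D| = 2%N) (PD : D \notin finset.cover P).
Hypothesis (meetD : forall I, I \in t -> #|(D :&: I)%SET| = 1%N).
Hypotheses (wD : W t sg (mid D)) (sg0 : forall I, I \in t -> 0 < sg I).

Definition cone v : {set {set A}} := (D |: t :\ v)%SET.

Definition star_subdivision : {set {set {set A}}} :=
  (P :\ t :|: [set cone v | v in t])%SET.

Lemma apex_notin s : s \in P -> D \notin s.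
Proof. by move=> sP; apply: contraNN PD; apply: cover_mem. Qed.

Lemma big_cone (V : nmodType) v (F : {set A} -> V) :
  \sum_(I in cone v) F I = F D + \sum_(I in (t :\ v)%SET) F I.
Proof. by rewrite big_setU1 // !inE negb_and (apex_notin tP) orbT. Qed.

Lemma weights_of_cone v k x : v \in t -> W (cone v) k x ->
  W t (fun I => (if I == v then 0 else k I) + k D * sg I) x.
Proof.
move=> tv [s1 s2]; have [d1 d2] := wD.
have sum (V : nmodType) (F G : {set A} -> V) : (forall I, F I = if I == v then 0 else G I) ->
    \sum_(I in t) F I = \sum_(I in (t :\ v)%SET) G I.
  move=> h; rewrite (big_setD1 v) //= h eqxx add0r; apply: eq_bigr => I.
  by rewrite !inE h => /andP[/negPf ->].
split.
  rewrite big_split /= -mulr_sumr d1 mulr1 -s1 big_cone addrC.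
  by congr (_ + _); apply: sum.
under eq_bigr do rewrite scalerDl -scalerA.
rewrite big_split /= -scaler_sumr d2 -s2 big_cone addrC.
by congr (_ + _); apply: sum => I; case: ifP => // _; rewrite scale0r.
Qed.

(** Subtracting the multiple [l v / sg v] of the coordinates of the apex eliminates [v]; the apex
    receives that multiple. *)
Definition cone_weights v l I : R :=
  if I == D then l v / sg v else l I - l v / sg v * sg I.

Lemma weights_to_cone v l x : v \in t -> W t l x -> W (cone v) (cone_weights v l) x.
Proof.
move=> tv [s1 s2]; have [d1 d2] := wD.
have sv : sg v != 0 by rewrite gt_eqF // sg0.
have E I : I \in (t :\ v)%SET -> cone_weights v l I = l I - l v / sg v * sg I.
  rewrite !inE /cone_weights => /andP[_ tI]; case: eqP => // ID.
  by move: (apex_notin tP); rewrite -ID tI.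
move: s1 s2 d1 d2; rewrite !(big_setD1 v tv) /= => s1 s2 d1 d2.
split; rewrite big_cone {1}/cone_weights eqxx.
  rewrite (eq_bigr _ E) big_split /= sumrN -mulr_sumr.
  have -> : \sum_(I in (t :\ v)%SET) sg I = 1 - sg v by rewrite -d1 addrC addrK.
  have -> : \sum_(I in (t :\ v)%SET) l I = 1 - l v by rewrite -s1 addrC addrK.
  by field.
rewrite (eq_bigr (fun I => l I *: mid I - (l v / sg v) *: (sg I *: mid I))); last first.
  by move=> I tI; rewrite E // scalerBl scalerA.
rewrite big_split /= sumrN -scaler_sumr.
set S := \sum_(I in _) l I *: _ in s2 *; set T := \sum_(I in _) sg I *: _ in d2 *.
by rewrite -d2 -s2; apply/rV2P; rewrite !mxE; split; field.
Qed.

(* The cone opposite [v] is where the ratio [l v / sg v] of the coordinates of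
   the point to those of the apex is minimal. *)
Lemma cone_hullP v x : v \in t -> conv_hull (corners (cone v)) x <->
  exists2 l, W t l x & forall I, I \in t -> 0 <= l I /\ l v * sg I <= l I * sg v.
Proof.
move=> tv; have sv := sg0 tv; split.
  move=> /hull_weights [k wk k0]; exists (fun I => (if I == v then 0 else k I) + k D * sg I).
    exact: weights_of_cone.
  have kD : 0 <= k D by apply: k0; rewrite !inE eqxx.
  move=> I tI; have sI := sg0 tI; rewrite eqxx add0r.
  have kI : 0 <= if I == v then 0 else k I.
    by case: ifP => // /negbT Iv; apply: k0; rewrite !inE Iv tI orbT.
  split; first by rewrite addr_ge0 // mulr_ge0 // ltW.
  by rewrite mulrDl mulrAC lerDr mulr_ge0 // ltW.
move=> [l wl l0]; apply/hull_weights; exists (cone_weights v l).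
  exact: weights_to_cone.
move=> I; rewrite !inE /cone_weights; case: eqP => [_ _|_ /= /andP[_ tI]].
  by rewrite divr_ge0 ?(ltW sv) //; case: (l0 _ tv).
by rewrite subr_ge0 mulrAC ler_pdivrMr //; case: (l0 _ tI).
Qed.

Lemma cone_hull_sub v x : v \in t -> conv_hull (corners (cone v)) x -> conv_hull (corners t) x.
Proof.
move=> tv /(cone_hullP _ tv) [l wl l0]; apply/hull_weights; exists l => // I tI.
by case: (l0 I tI).
Qed.

Lemma star_cover x : conv_hull (corners t) x ->
  exists2 v, v \in t & conv_hull (corners (cone v)) x.
Proof.
move=> /hull_weights [l wl l0].
have [v0 tv0] : exists v, v \in t.
  by apply/card_gt0P; rewrite (triangle_card hP tP).
have [v tv h] := @exists_min _ _ (fun v => v \in t) (fun v => l v / sg v) _ tv0.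
exists v => //; apply/cone_hullP => //; exists l => // I tI; split; first exact: l0.
by have := h I tI; rewrite ler_pdivrMr ?sg0 // mulrAC ler_pdivlMr ?sg0.
Qed.

(** Some vertex of [t] is missing from [s], so its coordinate at [x] is zero. The ratio at [v] is
    minimal, hence zero too, and [x] lies on a face of [t] that avoids [v]. *)
Lemma star_cap_cone v s x : s \in P -> s != t -> v \in t ->
  conv_hull (corners s) x -> conv_hull (corners (cone v)) x ->
  conv_hull (corners (s :&: cone v)%SET) x.
Proof.
move=> sP st tv sx cx; have tx := cone_hull_sub tv cx.
move/(cone_hullP _ tv): (cx) => [l wl l0].
have ls := weights_cap hP tP sP wl tx sx.
have [J tJ sJ] : exists2 J, J \in t & J \notin s.
  apply/fintype.subsetPn; apply: contra_neqN st => ts.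
  by apply/eqP; rewrite eq_sym eqEcard ts (triangle_card hP tP) (triangle_card hP sP).
have lJ : l J = 0 by apply/eqP; apply: contraNT sJ; apply: ls.
have lv : l v = 0.
  have [_] := l0 J tJ; rewrite lJ mul0r => h; apply/eqP.
  by rewrite eq_le (l0 v tv).1 andbT -(pmulr_lle0 _ (sg0 tJ)).
apply/hull_weights; exists (fun I => if I \in t then l I else 0); last first.
  by move=> I _; case: ifP => // /l0 [].
have wl0 I : I \in t -> I \notin (s :&: cone v)%SET -> l I = 0.
  move=> tI; rewrite !inE negb_and => /orP[sI|].
    by apply/eqP; apply: contraNT sI; apply: ls.
  by rewrite negb_or => /andP[_]; rewrite tI andbT negbK => /eqP ->.
have sub (V : nmodType) (F : {set A} -> V) :
   (forall I, I \in t -> I \notin (s :&: cone v)%SET -> F I = 0) ->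
   \sum_(I in (s :&: cone v)%SET) F I = \sum_(I in t) F I.
  move=> F0; have sct : (s :&: cone v)%SET \subset t.
    apply/fintype.subsetP => I; rewrite !inE => /andP[sI /orP[/eqP ID|/andP[]//]].
    by move: (apex_notin sP); rewrite -ID sI.
  by rewrite [RHS](big_setID (s :&: cone v)%SET) /= (finset.setIidPr sct)
    [X in _ + X]big1 ?addr0 // => I; rewrite !finset.inE => /andP[nI tI]; apply: F0; rewrite ?inE.
have [s1 s2] := wl; split.
  rewrite sub => [|I tI nI]; last by rewrite tI wl0.
  by rewrite -s1; apply: eq_bigr => I ->.
rewrite sub => [|I tI nI]; last by rewrite tI wl0 // scale0r.
by rewrite -s2; apply: eq_bigr => I ->.
Qed.

(** Both ratios are minimal, hence equal, and the weight of [w] in the cone opposite [v]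
    vanishes. *)
Lemma star_cap_cones v w x : v \in t -> w \in t -> v != w ->
  conv_hull (corners (cone v)) x -> conv_hull (corners (cone w)) x ->
  conv_hull (corners (cone v :&: cone w)%SET) x.
Proof.
move=> tv tw vw /(cone_hullP _ tv) [l wl l0] /(cone_hullP _ tw) [l' wl' l0'].
have uq := (triangle_simplex hP tP).1 _ _ _ wl wl'.
have e : l v * sg w = l w * sg v.
  apply/eqP; rewrite eq_le (l0 w tw).2 /=.
  by have [_] := l0' v tv; rewrite -!uq.
have sv := sg0 tv.
have cw : cone_weights v l w = 0.
  rewrite /cone_weights; case: eqP => [wD'|_].
    by move: (apex_notin tP); rewrite -wD' tw.
  by apply/eqP; rewrite subr_eq0 mulrAC e mulfK // gt_eqF.
have [s1 s2] := weights_to_cone tv wl.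
apply/hull_weights; exists (cone_weights v l).
  have wc : w \in (t :\ v)%SET by rewrite !inE eq_sym vw.
  have ec : (cone v :&: cone w)%SET = (D |: t :\ v :\ w)%SET.
    apply/setP => I; rewrite !inE; case: (I == D) => //=.
    by case: (I == v); case: (I == w); case: (I \in t).
  have Dn : D \notin (t :\ v :\ w)%SET by rewrite !inE (negPf (apex_notin tP)) !andbF.
  move: s1 s2; rewrite !big_cone !(big_setD1 w wc) /= cw scale0r !add0r => s1 s2.
  by split; rewrite ec big_setU1.
move=> I; rewrite !inE /cone_weights; case: eqP => [_ _|_ /= /andP[/andP[_ tI] _]].
  by rewrite divr_ge0 ?(ltW sv) //; case: (l0 _ tv).
by rewrite subr_ge0 mulrAC ler_pdivrMr //; case: (l0 _ tI).
Qed.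

Lemma starP u : u \in star_subdivision ->
  (u \in P /\ u != t) \/ exists2 v, v \in t & u = cone v.
Proof.
rewrite !inE => /orP[/andP[ut uP]|/imsetP [v tv ->]]; first by left.
by right; exists v.
Qed.

Lemma star_old u : u \in P -> u != t -> u \in star_subdivision.
Proof. by move=> uP ut; rewrite !inE ut uP. Qed.

Lemma star_cone v : v \in t -> cone v \in star_subdivision.
Proof. by move=> tv; rewrite inE imset_f ?orbT. Qed.

Lemma star_labels I : I \in finset.cover star_subdivision ->
  I = D \/ I \in finset.cover P.
Proof.
move=> /bigcupP [u /starP[[uP _] uI|[v tv ->]]]; first by right; apply: cover_mem uI.
by rewrite !inE => /orP[/eqP|/andP[_ tI]]; [left|right; apply: cover_mem tI].
Qed.

Lemma apex_hull : conv_hull (corners t) (mid D).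
Proof. by apply/hull_weights; exists sg => // I /sg0/ltW. Qed.

(** A new label could still sit at the position of an old vertex. But [mid D] is strictly inside
    [t], where a vertex in use would have to be a corner. *)
Lemma apex_mid I : I \in finset.cover P -> mid I != mid D.
Proof.
move=> PI; apply/eqP => E; have tI : I \in t.
  by apply: (vertex_mem hP tP PI); rewrite E; apply: apex_hull.
have c3 := triangle_card hP tP.
have /card_gt0P [J] : (0 < #|(t :\ I)%SET|)%N.
  by have := cardsD1 I t; rewrite tI c3 add1n => -[<-].
rewrite !inE => /andP[/negPf JI tJ].
have := weights_vertex (@mid R A) tI; rewrite E => wI.
have := (triangle_simplex hP tP).1 _ _ _ wD wI J tJ; rewrite JI => /eqP.
by rewrite gt_eqF ?sg0.
Qed.

Lemma corners3 I J K :
  corners [set I; J; K]%SET = [set mid I; mid J; mid K]%classic.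
Proof.
rewrite eqEsubset; split=> x /=.
  by move=> [M /=]; rewrite !inE -orbA => /or3P[] /eqP -> <-; [left; left|left; right|right].
by move=> [[|]|] ->; [exists I|exists J|exists K] => //=; rewrite !inE eqxx ?orbT.
Qed.

Lemma triangle_cross I J K : t = [set I; J; K]%SET ->
  cross (mid J - mid I) (mid K - mid I) != 0.
Proof.
move=> et; case: hP => _ _ [tri _ _] _.
have [|[a [b [c [e nc]]]] _] := tri (corners t); first by exists t.
apply/noncollinearP => -[p [v h]]; apply: nc; exists p, v => x xs; apply: h.
have : corners t x.
  by rewrite e; move: xs; rewrite !inE => /or3P[] /eqP ->; [left; left|left; right|right].
rewrite et corners3 !inE => -[[|]|] ->; rewrite eqxx ?orbT //.
Qed.

Lemma cone_triangle v : v \in t -> is_triangle (corners (cone v)).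
Proof.
move=> tv; have c3 := triangle_card hP tP.
have /card_gt0P [J] : (0 < #|(t :\ v)%SET|)%N.
  by have := cardsD1 v t; rewrite tv c3 add1n => -[<-].
rewrite !inE eq_sym => /andP[vJ tJ].
have [K u et] := set3_of_card c3 tv tJ vJ.
have ec : cone v = [set D; J; K]%SET.
  have := u; rewrite uniq3 => /and3P[/negPf vJ' /negPf vK _].
  apply/setP => M; rewrite /cone et !inE; case: (M == D) => //=.
  by have [->|] := eqVneq M v; rewrite ?vJ' ?vK.
exists (mid D), (mid J), (mid K); rewrite ec corners3; split=> //; apply/noncollinearP.
have [s1 s2] := wD; move: s1 s2; rewrite et !big_set3 // => s1 s2.
suff -> : cross (mid J - mid D) (mid K - mid D) =
    sg v * cross (mid J - mid v) (mid K - mid v).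
  by rewrite mulf_neq0 ?triangle_cross // gt_eqF // sg0.
have -> : sg v = 1 - sg J - sg K by rewrite -s1; ring.
rewrite -s2; have -> : sg v = 1 - sg J - sg K by rewrite -s1; ring.
by rewrite /cross !mxE; ring.
Qed.

Lemma cone_meet v I J : v \in t -> I \in cone v -> J \in cone v -> I != J ->
  #|(I :&: J)%SET| = 1%N.
Proof.
move=> tv; rewrite !inE => /orP[/eqP ->|/andP[_ tI]] /orP[/eqP ->|/andP[_ tJ]] IJ.
- by rewrite eqxx in IJ.
- exact: meetD.
- by rewrite finset.setIC; apply: meetD.
exact: (triangle_meet hP tP).
Qed.

Lemma star_cap u u' x : u \in star_subdivision -> u' \in star_subdivision ->
  conv_hull (corners u) x -> conv_hull (corners u') x ->
  conv_hull (corners (u :&: u')%SET) x.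
Proof.
move=> /starP[[uP ut]|[v tv ->]] /starP[[uP' ut']|[w tw ->]] ux ux'.
- exact: (hull_cap hP).
- exact: star_cap_cone.
- by rewrite finset.setIC; apply: star_cap_cone.
have [<-|vw] := eqVneq v w; first by rewrite finset.setIid.
exact: star_cap_cones.
Qed.

Lemma star_hypertriangulation : is_hypertriangulation star_subdivision.
Proof.
have [h1 inj [tri cov cap] h4] := hP; split.
- by move=> I /star_labels[->|] //; apply: h1.
- move=> I J /star_labels[->|PI] /star_labels[->|PJ] //.
  + by move/esym/eqP; rewrite (negPf (apex_mid PJ)).
  + by move/eqP; rewrite (negPf (apex_mid PI)).
  exact: inj.
- split.
  + move=> _ [u /starP[[uP _]|[v tv ->]] <-]; first by apply: tri; exists u.
    split; first exact: cone_triangle.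
    move=> _ [I /= + <-]; rewrite !inE => /orP[/eqP ->|/andP[_ tI]].
      exact: midpoints_mid.
    by apply: midpoints_mid; apply: (label_card hP (cover_mem tP tI)).
  + rewrite -cov eqEsubset; split=> x [_ [u Qu <-] ux].
      case/starP: Qu ux => [[uP _] ux|[v tv ->] vx]; first by exists (corners u) => //; exists u.
      exists (corners t); first by exists t.
      exact: cone_hull_sub vx.
    have [eut|ut] := eqVneq u t.
      rewrite eut in ux; have [v tv vx] := star_cover ux.
      by exists (corners (cone v)) => //; exists (cone v) => //=; apply: star_cone.
    by exists (corners u) => //; exists u => //=; apply: star_old.
  move=> _ _ [u Qu <-] [u' Qu' <-]; rewrite eqEsubset; split=> x.
    move=> [ux ux']; have := star_cap Qu Qu' ux ux'.
    move=> h M [cM sM]; apply: h; split=> // _ [I + <-]; rewrite /= inE => /andP[uI uI'].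
    by apply: sM; split; exists I.
  by move=> h; split=> M [cM sM]; apply: h; split=> // z [zu zu']; apply: sM.
move=> u I J /starP[[uP _]|[v tv ->]]; first exact: h4.
exact: cone_meet.
Qed.

Lemma star_subdivides : subdivides star_subdivision P.
Proof.
split.
  apply/fintype.subsetP => I /bigcupP [u uP uI].
  have [eut|ut] := eqVneq u t; last by apply/bigcupP; exists u => //; apply: star_old.
  rewrite eut in uI.
  have /card_gt0P [v] : (0 < #|(t :\ I)%SET|)%N.
    by have := cardsD1 I t; rewrite uI (triangle_card hP tP) add1n => -[<-].
  rewrite !inE => /andP[vI tv]; apply/bigcupP; exists (cone v); first exact: star_cone.
  by rewrite !inE uI (eq_sym I v) vI orbT.
move=> u /starP[[uP _]|[v tv ->]]; first by exists u.
by exists t => // x; apply: cone_hull_sub.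
Qed.

Lemma star_neq : star_subdivision <> P.
Proof.
move=> e; move/negP: PD; apply.
have /card_gt0P [v tv] : (0 < #|t|)%N by rewrite (triangle_card hP tP).
by rewrite -e; apply/bigcupP; exists (cone v); [exact: star_cone | rewrite !inE eqxx].
Qed.

End Subdivision.

(** * Delaunay triangles *)

Section Delaunay.
Variables (R : realType) (A : {fset 'rV[R]_2}).
Implicit Types (a b c d e p y : A) (I J K L : {set A}) (s t u : {set {set A}}).
Hypothesis gen : generic A.

Local Notation W := (weights (@mid R A)).
Local Notation pw t p := (pow (circ t) (val p)).

Lemma set2_inj y a b : y != a -> ([set y; a] == [set y; b])%SET = (a == b).
Proof.
move=> ya; apply/eqP/eqP => [/setP /(_ a)|-> //].
by rewrite !inE eqxx orbT eq_sym (negPf ya) => /esym/eqP.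
Qed.

Lemma black_uniq a b c : uniq [:: a; b; c] ->
  uniq [:: [set a; b]; [set a; c]; [set b; c]]%SET.
Proof.
rewrite !uniq3 => /and3P[ab ac bc].
have [ba ca cb] : [/\ b != a, c != a & c != b] by split; rewrite eq_sym.
apply/and3P; split; first by rewrite set2_inj.
  by rewrite (finset.setUC [set a]%SET) set2_inj.
by rewrite (finset.setUC [set a]%SET) (finset.setUC [set b]%SET) set2_inj.
Qed.

Lemma pair_black a b c p q : p != q -> p \in [set a; b; c]%SET ->
  q \in [set a; b; c]%SET -> [set p; q]%SET \in black_triangle a b c.
Proof.
move=> pq; rewrite /black_triangle.
have mem3 (I J K M : {set A}) : M = I \/ M = J \/ M = K -> M \in [set I; J; K]%SET.
  by case=> [->|[->|->]]; rewrite !inE eqxx ?orbT.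
move=> pt qt; apply: mem3; move: pt qt pq; rewrite !inE -!orbA.
move=> /or3P[] /eqP -> /or3P[] /eqP ->; rewrite ?eqxx //= => _;
  rewrite ?(finset.setUC [set b]%SET [set a]%SET) ?(finset.setUC [set c]%SET [set a]%SET)
    ?(finset.setUC [set c]%SET [set b]%SET); by [left|right; left|right; right].
Qed.

Lemma white_uniq y a b c : uniq [:: y; a; b; c] ->
  uniq [:: [set y; a]; [set y; b]; [set y; c]]%SET.
Proof.
by rewrite uniq3 uniq4 => /and5P[ya yb yc ab /andP[ac bc]]; rewrite !set2_inj // ab ac bc.
Qed.

Lemma point_weights a b c (x : 'rV[R]_2) : uniq [:: a; b; c] ->
  exists l, weights (fun p : A => val p) [set a; b; c]%SET l x.
Proof.
by move=> u; apply: (simplex_triangle u _).2; apply: generic_cross.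
Qed.

Lemma point_weights_neq0 a b c d l : uniq [:: a; b; c; d] ->
  weights (fun p : A => val p) [set a; b; c]%SET l (val d) -> l a != 0.
Proof.
move=> u [s1 s2]; have := u; rewrite uniq4 => /and5P[ab ac ad bc /andP[bd cd]].
have ubcd : uniq [:: b; c; d] by rewrite uniq3 bc bd cd.
have uabc : uniq [:: a; b; c] by rewrite uniq3 ab ac bc.
apply: contra_neq (generic_cross gen ubcd) => la.
rewrite !big_set3 // la in s1 s2; rewrite -s2.
have -> : l b = 1 - l c by rewrite -s1; ring.
by rewrite /cross !mxE; ring.
Qed.

Lemma set3_rot (T : finType) (i j k : T) : [set i; j; k]%SET = [set j; k; i]%SET.
Proof. by apply/setP => m; rewrite !inE -orbA orbC. Qed.

Lemma uniq3_rot (T : eqType) (i j k : T) : uniq [:: i; j; k] -> uniq [:: j; k; i].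
Proof. by rewrite -(rot_uniq 1). Qed.

Lemma uniq4_rot (T : eqType) (h i j k : T) : uniq [:: h; i; j; k] -> uniq [:: h; j; k; i].
Proof. by rewrite !uniq4 => /and5P[-> -> -> ij /andP[ik ->]]; rewrite eq_sym ij eq_sym ik. Qed.

Lemma uniq4_tail (T : eqType) (h i j k : T) : uniq [:: h; i; j; k] -> uniq [:: i; j; k].
Proof. by case/andP. Qed.

Lemma weights_white y a b c (i j k : R) : uniq [:: y; a; b; c] -> i + j + k = 1 ->
  W (white_triangle y a b c)
    (fun I => if I == [set y; a]%SET then i else if I == [set y; b]%SET then j else k)
    (2^-1 *: (val y + (i *: val a + j *: val b + k *: val c))).
Proof.
move=> u s1; have := u; rewrite uniq4 => /and5P[ya yb yc ab /andP[ac bc]].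
have us := white_uniq u.
have [ba ca cb] : [/\ (b == a) = false, (c == a) = false & (c == b) = false].
  by split; rewrite eq_sym; apply: negPf.
split; rewrite big_set3 // !eqxx !set2_inj // ba ca cb //.
rewrite !mid2 //.
have -> : i = 1 - j - k by rewrite -s1; ring.
by apply/rV2P; rewrite !mxE; split; field.
Qed.

(** This rests on a = [ab] + [ac] - [bc]. For d with coordinates i, j, k, the point [ad] is beyond
    the edge [ab][ac] exactly when i is positive, that is, when d is on the side of [a] of the line
    bc. *)
Lemma weights_black a b c (i j k : R) : uniq [:: a; b; c] -> i + j + k = 1 ->
  W (black_triangle a b c)
    (fun I => if I == [set a; b]%SET then i + j
      else if I == [set a; c]%SET then i + k else - i)
    (2^-1 *: (val a + (i *: val a + j *: val b + k *: val c))).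
Proof.
move=> u s1; have := u; rewrite uniq3 => /and3P[ab ac bc].
have us := black_uniq u.
have := us; rewrite uniq3 => /and3P[n1 n2 n3].
have [e1 e2 e3] : [/\ ([set a; c] == [set a; b])%SET = false,
    ([set b; c] == [set a; b])%SET = false & ([set b; c] == [set a; c])%SET = false].
  by split; rewrite eq_sym; apply: negPf.
split; rewrite big_set3 // !eqxx e1 e2 e3; first by rewrite -s1; ring.
rewrite !mid2 //.
have -> : i = 1 - j - k by rewrite -s1; ring.
by apply/rV2P; rewrite !mxE; split; field.
Qed.

Lemma labelled_card3 t : labelled t -> #|t| = 3%N.
Proof.
have card3 I J K : uniq [:: I; J; K] -> #|[set I; J; K]%SET| = 3%N.
  by move=> /card_uniqP /= <-; apply: eq_card => M; rewrite !inE -orbA.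
case=> [[a [b [c [u ->]]]]|[y [a [b [c [u ->]]]]]]; apply: card3.
  exact: black_uniq.
exact: white_uniq.
Qed.

Lemma inside_pow C a b c p : uniq [:: a; b; c] ->
  pow C (val a) = 0 -> pow C (val b) = 0 -> pow C (val c) = 0 ->
  inside_circumcircle (val a) (val b) (val c) (val p) <-> pow C (val p) < 0.
Proof. by move=> u; apply: inside_circumcircleP; apply: generic_cross. Qed.

Lemma delaunay_labelled t : t \in order2_delaunay A -> labelled t.
Proof.
rewrite inE => /asboolP [[a [b [c [u _ et]]]]|[a [b [c [y [u hin et]]]]]].
  by left; exists a, b, c.
right; exists y, a, b, c; split=> //.
have lt : labelled (black_triangle a b c) by left; exists a, b, c.
have [pa pb pc] := pow_black gen u.
have /(inside_pow _ u pa pb pc) py := (hin y).2 erefl.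
rewrite cons_uniq u andbT !inE !negb_or.
by apply/and3P; split; apply: contraTneq py => ->; rewrite ?pa ?pb ?pc ltxx.
Qed.

Lemma pow_neq0 C a b c p : uniq [:: a; b; c] ->
  pow C (val a) = 0 -> pow C (val b) = 0 -> pow C (val c) = 0 ->
  p \notin [set a; b; c]%SET -> pow C (val p) != 0.
Proof.
move=> u pa pb pc; rewrite !inE !negb_or -andbA => /and3P[na nb nc].
apply: (generic_pow gen _ pa pb pc); move: u; rewrite uniq3 uniq4 => /and3P[-> -> ->].
by rewrite ![_ == p]eq_sym na nb nc.
Qed.

(** For a black triangle all powers are nonnegative. For a white one only that of [y] is negative:
    it cancels from pairs through [y] and enters the other pairs with a plus sign. Genericity leaves
    power zero to the rim alone. *)
Lemma delaunay_excess t I : t \in order2_delaunay A -> #|I| = 2%N ->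
  0 <= excess t I /\ (excess t I = 0 -> I \in t).
Proof.
move=> tD; have := delaunay_labelled tD; move: tD.
rewrite inE => /asboolP [[a [b [c [u hin et]]]]|[a [b [c [y [u hin et]]]]]] lt.
  rewrite {}et in lt *; move=> /eqP/cards2P [p [q [pq ->]]].
  have [pa pb pc] := pow_black gen u.
  have ge0 (x : A) : 0 <= pw (black_triangle a b c) x.
    by rewrite leNgt; apply/negP => lt0; apply: (hin x); apply/(inside_pow x u pa pb pc).
  have gt0 (x : A) : pw (black_triangle a b c) x = 0 -> x \in [set a; b; c]%SET.
    by move/eqP; apply: contraLR; apply: pow_neq0.
  rewrite -/(black_triangle a b c) excess_black //; split; first by rewrite addr_ge0.
  by move/eqP; rewrite paddr_eq0 // => /andP[/eqP/gt0 pt /eqP/gt0 qt]; apply: pair_black.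
have uy : uniq [:: y; a; b; c].
  have [pa pb pc] := pow_black gen u.
  have /(inside_pow _ u pa pb pc) py := (hin y).2 erefl.
  rewrite cons_uniq u andbT !inE !negb_or.
  by apply/and3P; split; apply: contraTneq py => ->; rewrite ?pa ?pb ?pc ltxx.
rewrite {}et in lt *; have [pa pb pc] := pow_white gen uy.
have py : pw (white_triangle y a b c) y < 0 by apply/(inside_pow _ u pa pb pc)/hin.
have ge0 (x : A) : x != y -> 0 <= pw (white_triangle y a b c) x.
  move=> xy; rewrite leNgt; apply/negP => lt0.
  have E : x = y by apply/hin/(inside_pow x u pa pb pc).
  by rewrite E eqxx in xy.
have gt0 (x : A) : pw (white_triangle y a b c) x = 0 -> x \in [set a; b; c]%SET.
  by move/eqP; apply: contraLR; apply: pow_neq0.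
move=> cI; rewrite -/(white_triangle y a b c).
have [yI|yI] := boolP (y \in I).
  have [q yq ->] := card2_mem cI yI; rewrite excess_white // addrAC subrr add0r.
  split; first by rewrite ge0 // eq_sym.
  by move/gt0; rewrite !inE -orbA => /or3P[] /eqP ->; rewrite eqxx ?orbT.
move/eqP/cards2P: cI yI => [p [q [pq ->]]].
rewrite !inE negb_or eq_sym (eq_sym y) => /andP[py' qy']; rewrite excess_white //.
have : 0 < pw (white_triangle y a b c) p + pw (white_triangle y a b c) q -
    pw (white_triangle y a b c) y.
  by rewrite ltr_wpDl ?oppr_gt0 // addr_ge0 // ge0.
by move=> gt; split; [exact: ltW | move=> e0; rewrite e0 ltxx in gt].
Qed.

Lemma labelled_sub_hull t x : labelled t -> conv_hull (corners t) x ->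
  conv_hull (midpoints A) x.
Proof.
move=> lt tx M [cM mM]; apply: tx; split=> // _ [I tI <-].
by apply: mM; apply: midpoints_mid; apply: labelled_card tI.
Qed.

(* The barycentre of a Delaunay triangle [t] lies in some [u] of [P]; as neither
   lift has a vertex below the plane of the other, the planes agree there, and
   the strictness in [delaunay_excess] forces [t = u]. *)
Lemma sub_delaunay_eq (P : {set {set {set A}}}) : is_hypertriangulation P ->
  P \subset order2_delaunay A -> P = order2_delaunay A.
Proof.
move=> hP PD; apply/eqP; rewrite finset.eqEsubset PD /=; apply/fintype.subsetP => t tD.
have lt := delaunay_labelled tD.
have n0 : (#|t|%:R : R) != 0 by rewrite (labelled_card3 lt) pnatr_eq0.
pose x : 'rV[R]_2 := \sum_(I in t) #|t|%:R^-1 *: mid I.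
have wx : W t (fun=> #|t|%:R^-1) x.
  by split=> //; rewrite sumr_const -[X in X = _]mulr_natl mulfV.
have hx : conv_hull (corners t) x.
  by apply/hull_weights; exists (fun=> #|t|%:R^-1) => // I _; rewrite invr_ge0.
have [u uP ux] := hull_cover hP (labelled_sub_hull lt hx).
have uD := fintype.subsetP PD _ uP; have lu := delaunay_labelled uD.
move/hull_weights: ux => [l wl l0].
have [w [k h]] := excess_affine t u.
have Et I : I \in t -> 0 <= excess u I.
  by move=> tI; have [] := delaunay_excess uD (labelled_card lt tI).
(* Evaluated at the vertices of [t], the affine difference at [x] is a sum of nonnegative terms;
   evaluated at those of [u], it is at most zero. All weights of a barycentre are positive, so every
   term vanishes. *)
have E1 : dot w x + k = \sum_(I in t) #|t|%:R^-1 * excess u I.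
  rewrite (weights_affine w k wx); apply: eq_bigr => I tI.
  by rewrite -h ?(labelled_card lt) // (excess_self gen lt tI) subr0.
have E2 : dot w x + k <= 0.
  rewrite (weights_affine w k wl) -oppr_ge0 -sumrN; apply: sumr_ge0 => I uI.
  have cI := labelled_card lu uI.
  rewrite -h // (excess_self gen lu uI) sub0r mulrN opprK mulr_ge0 ?l0 //.
  by have [] := delaunay_excess tD cI.
have tu : t \subset u.
  apply/fintype.subsetP => I tI.
  have [_] := delaunay_excess uD (labelled_card lt tI); apply.
  have : \sum_(I in t) #|t|%:R^-1 * excess u I == 0.
    by rewrite eq_le -{1}E1 E2 sumr_ge0 // => J tJ; rewrite mulr_ge0 ?Et // invr_ge0.
  rewrite psumr_eq0 => [/allP /(_ I)|J tJ]; last by rewrite mulr_ge0 ?Et // invr_ge0.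
  by rewrite mem_index_enum tI /= mulf_eq0 invr_eq0 (negPf n0) => /(_ isT) /eqP.
suff -> : t = u by [].
by apply/eqP; rewrite eqEcard tu !labelled_card3.
Qed.

End Delaunay.

(** * From local to global *)

Section LocalToGlobal.
Variables (R : realType) (A : {fset 'rV[R]_2}) (P : {set {set {set A}}}).
Implicit Types (a b c d e p y : A) (I J K L : {set A}) (s t u : {set {set A}}).
Hypothesis gen : generic A.
Hypothesis maxP : maximal_hypertriangulation P.
Hypothesis lapP : local_angle_property P.

Let hP : is_hypertriangulation P := maxP.1.

Local Notation W := (weights (@mid R A)).
Local Notation pw t p := (pow (circ t) (val p)).

(* At a pair (t, I) of least excess, crossing the edge of [t] that separates it
   from [mid I] would decrease the excess, by local convexity. *)
Lemma excess_cover t I : t \in P -> I \in finset.cover P -> 0 <= excess t I.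
Proof.
move=> tP0 PI0; pose Q (x : {set {set A}} * {set A}) := x.1 \in P /\ x.2 \in finset.cover P.
have [] := @exists_min R _ Q (fun x => excess x.1 x.2) (t, I) (conj tP0 PI0).
move=> [t' I'] [/= tP PI] hmin; apply: le_trans (hmin (t, I) (conj tP0 PI0)).
rewrite /= leNgt; apply/negP => neg.
have [l wl] := (triangle_simplex hP tP).2 (mid I').
(* Without a negative coordinate the vertex would lie in [t'], hence be a corner of it, where the
   excess is zero. *)
have [K tK lK] : exists2 K, K \in t' & l K < 0.
  apply/not_exists2P => h; move: neg; rewrite (excess_self gen (triangle_labelled hP tP)) ?ltxx //.
  apply: (vertex_mem hP tP PI); apply/hull_weights; exists l => // K tK.
  by rewrite leNgt; apply/negP; have [] := h K.
have hq : conv_hull (midpoints A) (mid I').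
  by apply: sub_conv_hull; apply: midpoints_mid; apply: label_card PI.
have [u [uP ut tu]] := neighbour hP tP tK hq wl lK.
have cI := label_card hP PI.
have := excess_weights gen (triangle_labelled hP tP) (triangle_labelled hP uP) tK tu cI wl.
have := hmin (u, I') (conj uP PI) => /= le E; move: le; rewrite E lerDl leNgt.
rewrite nmulr_rlt0 //.
have /card_gt0P [J] : (0 < #|(t' :\ K)%SET|)%N.
  by have := cardsD1 K t'; rewrite tK (triangle_card hP tP) add1n => -[<-].
rewrite !inE eq_sym => /andP[KJ tJ].
have [M uq et] := set3_of_card (triangle_card hP tP) tK tJ KJ.
have := uq; rewrite uniq3 => /and3P[_ KM JM].
have uJ : J \in u by apply: (fintype.subsetP tu); rewrite !inE eq_sym KJ tJ.
have uM : M \in u.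
  by apply: (fintype.subsetP tu); rewrite et !inE [M == K]eq_sym KM eqxx !orbT.
have [L uqL eu] := set3_of_card (triangle_card hP uP) uJ uM JM.
suff -> : 0 < excess u K by [].
apply: ((local_angle_excess gen hP).1 lapP u t' J M L K) => //; split.
- by move/eqP: ut.
- exact: uqL.
- exact: uniq3_rot.
- exact: eu.
by rewrite et set3_rot.
Qed.

(** In either colour the excess over [u] of the vertex [ya] is the power of [a]. So [excess_cover]
    keeps [a] from being inside the circle of [u], and genericity keeps it off that circle. *)
Lemma white_adjacent y a b c u : uniq [:: y; a; b; c] -> white_triangle y a b c \in P ->
  u \in P -> u != white_triangle y a b c ->
  (white_triangle y a b c :\ [set y; a])%SET \subset u ->
  [/\ pw u b = 0, pw u c = 0, 0 < pw u a &
     u = black_triangle y b c \/ exists2 e, uniq [:: y; b; c; e] & u = white_triangle y b c e].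
Proof.
move=> uq tP uP ut tu; have := uq; rewrite uniq4 => /and5P[ya yb yc ab /andP[ac bc]].
have := white_uniq uq; rewrite uniq3 => /and3P[n1 n2 _].
have ub : [set y; b]%SET \in u.
  apply: (fintype.subsetP tu); rewrite finset.in_setD1 eq_sym n1 /=.
  by rewrite !inE eqxx !orbT.
have uc : [set y; c]%SET \in u.
  apply: (fintype.subsetP tu); rewrite finset.in_setD1 eq_sym n2 /=.
  by rewrite !inE eqxx !orbT.
have uq3 : uniq [:: y; b; c] by rewrite uniq3 yb yc bc.
have PI : [set y; a]%SET \in finset.cover P.
  by apply: cover_mem tP _; rewrite !inE eqxx.
have E := excess_cover uP PI.
have cases := edge_cases hP uP uq3 ub uc.
case: (cases) => [eu|[e ue eu]]; rewrite -> eu in E, ut |- *.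
  have [py pb pc] := pow_black gen uq3.
  split; [by []|by []| |by left].
  rewrite excess_black // py add0r in E; rewrite lt_def E andbT.
  apply: (pow_neq0 gen uq3 py pb pc).
  by rewrite !inE !negb_or [a == y]eq_sym ya ab ac.
have [pb pc pe] := pow_white gen ue.
split; [by []|by []| |by right; exists e].
rewrite excess_white // addrAC subrr add0r in E; rewrite lt_def E andbT.
apply: (pow_neq0 gen (uniq4_tail ue) pb pc pe).
rewrite !inE !negb_or ab ac /=.
by apply: contraNneq ut => ->; rewrite -white_rot.
Qed.

Lemma labelled_core t y : labelled t -> y \in core t ->
  exists a b c, uniq [:: y; a; b; c] /\ t = white_triangle y a b c.
Proof.
case=> [[a [b [c [u ->]]]]|[z [a [b [c [u ->]]]]]].
  by rewrite /core core_black // inE.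
by rewrite /core core_white // inE => /eqP ->; exists a, b, c.
Qed.

Lemma white_wlog y a b c (Q : A -> Prop) : uniq [:: y; a; b; c] ->
  [\/ Q a, Q b | Q c] ->
  exists a' b' c', [/\ uniq [:: y; a'; b'; c'], white_triangle y a b c = white_triangle y a' b' c',
    [set a; b; c]%SET = [set a'; b'; c']%SET & Q a'].
Proof.
move=> u [h|h|h].
- by exists a, b, c.
- by exists b, c, a; split; [exact: uniq4_rot | exact: white_rot | exact: set3_rot |].
exists c, a, b; split; last exact: h.
- by apply: uniq4_rot; apply: uniq4_rot.
- by rewrite (white_rot y c).
by rewrite (set3_rot c).
Qed.

Lemma black_wlog a b c (Q : A -> Prop) : uniq [:: a; b; c] ->
  [\/ Q a, Q b | Q c] ->
  exists a' b' c', [/\ uniq [:: a'; b'; c'], black_triangle a b c = black_triangle a' b' c',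
    [set a; b; c]%SET = [set a'; b'; c']%SET & Q a'].
Proof.
move=> u [h|h|h].
- by exists a, b, c.
- by exists b, c, a; split; [exact: uniq3_rot | exact: black_rot | exact: set3_rot |].
exists c, a, b; split; last exact: h.
- by apply: uniq3_rot; apply: uniq3_rot.
- by rewrite (black_rot c).
by rewrite (set3_rot c).
Qed.

Lemma weight_pos a b c (x : 'rV[R]_2) l : uniq [:: a; b; c] ->
  weights (fun p : A => val p) [set a; b; c]%SET l x ->
  [\/ 0 < l a, 0 < l b | 0 < l c].
Proof.
move=> u [+ _]; rewrite big_set3 // => s1.
case: (ltrP 0 (l a)) => [|la]; first by constructor 1.
case: (ltrP 0 (l b)) => [|lb]; first by constructor 2.
by constructor 3; lra.
Qed.

(* Take [y] as far outside its circle as possible.  Some edge bc has y on the side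
   of a; across [yb][yc], towards [bc], a black triangle would put [bc] below the
   plane of [t], and a white one has a circle leaving [y] still further outside. *)
Lemma pow_core_max t y : t \in P -> y \in core t -> pw t y <= 0.
Proof.
move=> tP0 ty0; pose Q (x : {set {set A}} * A) := x.1 \in P /\ x.2 \in core x.1.
have [] := @exists_min R _ Q (fun x => - pw x.1 x.2) (t, y) (conj tP0 ty0).
move=> [t' z] [/= tP tz] hmin.
apply: le_trans (_ : pw t' z <= 0); first by have := hmin (t, y) (conj tP0 ty0); rewrite /= lerN2.
rewrite leNgt; apply/negP => pos.
have [a0 [b0 [c0 [u0 et0]]]] := labelled_core (triangle_labelled hP tP) tz.
have [l wl0] := point_weights gen (val z) (uniq4_tail u0).
have [a [b [c [uq et' es la]]]] := @white_wlog z a0 b0 c0 (fun p => 0 < l p) u0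
  (weight_pos (uniq4_tail u0) wl0).
have et := etrans et0 et'; have wl := wl0; rewrite es in wl.
have := uq; rewrite uniq4 => /and5P[ya yb yc ab /andP[ac bc]].
have [s1 s2] := wl; rewrite !big_set3 ?(uniq4_tail uq) // in s1 s2.
have := white_uniq uq; rewrite uniq3 => /and3P[n1 n2 n3].
(* These are the coordinates of b + c - z in abc, chosen because [bc] is the midpoint of z and b + c
   - z. *)
have s1' : - l a + (1 - l b) + (1 - l c) = 1 by lra.
have := weights_white uq s1'.
set q := 2^-1 *: _ => wq.
have eq : q = mid [set b; c]%SET.
  rewrite /q mid2 // -s2; apply/rV2P.
  have -> : l a = 1 - l b - l c by rewrite -s1; ring.
  by rewrite !mxE; split; ring.
have tK : [set z; a]%SET \in t' by rewrite et !inE eqxx.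
have hq : conv_hull (midpoints A) q.
  by rewrite eq; apply: sub_conv_hull; apply: midpoints_mid; rewrite cards2 bc.
rewrite -et in wq.
have [|u [uP ut tu]] := neighbour hP tP tK hq wq; first by rewrite eqxx oppr_lt0.
rewrite et in tP ut tu pos hmin.
have [pb pc pa [eu|[e ue eu]]] := white_adjacent uq tP uP ut tu.
  have PI : [set b; c]%SET \in finset.cover P.
    by apply: cover_mem uP _; rewrite eu !inE eqxx !orbT.
  have := excess_cover tP PI; have [_ qb qc] := pow_white gen uq.
  by rewrite excess_white // qb qc !add0r oppr_ge0 leNgt pos.
have [qa qb qc] := pow_white gen uq.
have := pow_weights (uniq4_tail uq) wl (C := circ u) (C' := circ (white_triangle z a b c)).
rewrite pb pc qb qc qa => /(_ erefl erefl) E.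
have uz : z \in core u by rewrite eu /core core_white // inE.
have := hmin (u, z) (conj uP uz); rewrite /= E lerN2 gerDl subr0 leNgt.
by rewrite mulr_gt0.
Qed.

Lemma pow_core_neg y a b c : uniq [:: y; a; b; c] -> white_triangle y a b c \in P ->
  pw (white_triangle y a b c) y < 0.
Proof.
move=> u tP; rewrite lt_neqAle pow_core_max ?andbT //; last by rewrite /core core_white // inE.
have [pa pb pc] := pow_white gen u; apply: (pow_neq0 gen (uniq4_tail u) pa pb pc).
by move: u; rewrite uniq4 !inE !negb_or => /and5P[-> -> -> _ _].
Qed.

Lemma mid_white y a b c d l : uniq [:: y; a; b; c] -> y != d ->
  weights (fun p : A => val p) [set a; b; c]%SET l (val d) ->
  W (white_triangle y a b c)
    (fun I => if I == [set y; a]%SET then l a else if I == [set y; b]%SET then l b else l c)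
    (mid [set y; d]%SET).
Proof.
move=> u yd [s1 s2]; rewrite !big_set3 ?(uniq4_tail u) // in s1 s2.
by rewrite mid2 // -s2; apply: weights_white.
Qed.

(** Otherwise the subdivision of the triangle at [yd] contradicts maximality. It is admissible
    because all its new edges join two different labels through [y]. *)
Lemma no_point_inside y a b c d l : uniq [:: y; a; b; c] -> white_triangle y a b c \in P ->
  y != d -> weights (fun p : A => val p) [set a; b; c]%SET l (val d) ->
  0 < l a -> 0 < l b -> 0 < l c -> [set y; d]%SET \in finset.cover P.
Proof.
move=> u tP yd wl la lb lc; apply: contraT => PD.
have := u; rewrite uniq4 => /and5P[ya yb yc ab /andP[ac bc]].
have wD := mid_white u yd wl.
have cD : #|[set y; d]%SET| = 2%N by rewrite cards2 yd.
have PM : forall M, M \in white_triangle y a b c -> [set y; d]%SET != M.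
  by move=> M tM; apply: contraNneq PD => ->; apply: cover_mem tM.
have sg0 I : I \in white_triangle y a b c ->
    0 < if I == [set y; a]%SET then l a else if I == [set y; b]%SET then l b else l c.
  by case: ifP => // _; case: ifP.
have meetD I : I \in white_triangle y a b c -> #|([set y; d] :&: I)%SET| = 1%N.
  move=> tI; have := PM _ tI; move: tI; rewrite !inE -orbA.
  by case/or3P => /eqP -> dn; apply: card_meet; rewrite uniq3 yd ?ya ?yb ?yc /=;
    apply: contra_neq dn => ->.
case: (star_neq hP tP PD).
apply: maxP.2; first exact: star_hypertriangulation meetD wD sg0.
exact: star_subdivides wD sg0.
Qed.

(* Take [d] as deep inside the circle of a triangle as possible.  The neighbour to
   cross into lies towards [yd] for a white triangle; for a black one it lies
   towards [ad], where bc has d on the side of a. *)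
Lemma pow_outside t d : t \in P -> d \notin core t -> 0 <= pw t d.
Proof.
move=> tP0 td0; pose Q (x : {set {set A}} * A) := x.1 \in P /\ x.2 \notin core x.1.
have [] := @exists_min R _ Q (fun x => pw x.1 x.2) (t, d) (conj tP0 td0).
move=> [t' d'] [/= tP td] hmin; apply: le_trans (hmin (t, d) (conj tP0 td0)).
rewrite /= leNgt; apply/negP => neg; clear t d tP0 td0; rename d' into d.
have descend u : u \in P -> d \notin core u -> ~ pw u d < pw t' d.
  by move=> uP ud; have := hmin (u, d) (conj uP ud); rewrite /= leNgt => /negP.
have notin a b c : pw t' a = 0 -> pw t' b = 0 -> pw t' c = 0 -> d \notin [set a; b; c]%SET.
  move=> pa pb pc; rewrite !inE; apply: contraTN neg => /orP[/orP[]|] /eqP ->;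
  by rewrite ?pa ?pb ?pc ltxx.
have [[a0 [b0 [c0 [u0 et0]]]]|[y [a0 [b0 [c0 [u0 et0]]]]]] := triangle_labelled hP tP.
  have [l wl0] := point_weights gen (val d) u0.
  have [a [b [c [uq et' es la]]]] := @black_wlog a0 b0 c0 (fun p => 0 < l p) u0
    (weight_pos u0 wl0).
  have et := etrans et0 et'; have wl := wl0; rewrite es in wl => {et0 et' es wl0 u0 a0 b0 c0}.
  rewrite {}et in tP td hmin neg descend notin; have [pa pb pc] := pow_black gen uq.
  have nd := notin _ _ _ pa pb pc.
  have ad : a != d by apply: contraNneq nd => <-; rewrite !inE eqxx.
  have := uq; rewrite uniq3 => /and3P[ab ac bc].
  have := black_uniq uq; rewrite uniq3 => /and3P[n1 n2 n3].
  have [s1 s2] := wl; rewrite !big_set3 // in s1 s2.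
  have := weights_black uq s1; rewrite s2 -mid2 // => wq.
  have tK : [set b; c]%SET \in black_triangle a b c by rewrite !inE eqxx orbT.
  have hq : conv_hull (midpoints A) (mid [set a; d]%SET).
    by apply: sub_conv_hull; apply: midpoints_mid; rewrite cards2 ad.
  have [|u [uP ut tu]] := neighbour hP tP tK hq wq.
    by rewrite [_ == [set a; b]%SET]eq_sym (negPf n2) eq_sym (negPf n3) oppr_lt0.
  have ub : [set a; b]%SET \in u.
    by apply: (fintype.subsetP tu); rewrite finset.in_setD1 n2 !inE eqxx.
  have uc : [set a; c]%SET \in u.
    by apply: (fintype.subsetP tu); rewrite finset.in_setD1 n3 !inE eqxx orbT.
  have [eu|[e ue eu]] := edge_cases hP uP uq ub uc; first by rewrite eu eqxx in ut.
  rewrite {}eu in uP ut tu ub uc.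
  have [qb qc qe] := pow_white gen ue.
  have PI : [set b; c]%SET \in finset.cover P by apply: cover_mem tP tK.
  (* The vertex [bc] of the black triangle is not below the plane of [u], and its excess there is
     minus the power of [a]. *)
  have := excess_cover uP PI; rewrite excess_white // qb qc !add0r oppr_ge0 => qa.
  have {}qa : pw (white_triangle a b c e) a < 0.
    rewrite lt_neqAle qa andbT; apply: (pow_neq0 gen (uniq4_tail ue) qb qc qe).
    by move: ue; rewrite uniq4 !inE !negb_or => /and5P[-> -> -> _ _].
  apply: (descend _ uP); first by rewrite /core core_white // inE eq_sym.
  have := pow_weights uq wl (C := circ (white_triangle a b c e))
    (C' := circ (black_triangle a b c)).
  rewrite pb pc qb qc pa subr0 => /(_ erefl erefl) ->.
  by rewrite gtrDl pmulr_rlt0.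
have yd : y != d by move: td; rewrite et0 /core core_white // inE eq_sym.
have [l wl0] := point_weights gen (val d) (uniq4_tail u0).
(* Without a negative coordinate [d] is strictly inside the triangle, as genericity keeps it off the
   lines of the edges. Then [yd] is a vertex in use, and its excess is the negative power of [d],
   against [excess_cover]. *)
have [l0|] := pselect [\/ l a0 < 0, l b0 < 0 | l c0 < 0]; last first.
  move=> nl; have uq := uniq4_tail u0; have := u0.
  rewrite et0 in tP neg notin; have [pa pb pc] := pow_white gen u0.
  have nd := notin _ _ _ pa pb pc.
  have u4 : uniq [:: a0; b0; c0; d].
    move: nd uq; rewrite uniq3 uniq4 !inE !negb_or ![d == _]eq_sym.
    by move=> /andP[/andP[-> ->] ->] /and3P[-> -> ->].
  have na := point_weights_neq0 gen u4 wl0.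
  have u4' : uniq [:: b0; c0; a0; d].
    move: u4; rewrite !uniq4 => /and5P[ab ac ad bc /andP[bd cd]].
    by rewrite bc eq_sym ab bd eq_sym ac cd ad.
  have u4'' : uniq [:: c0; a0; b0; d].
    move: u4; rewrite !uniq4 => /and5P[ab ac ad bc /andP[bd cd]].
    by rewrite eq_sym ac eq_sym bc cd ab ad bd.
  have nb : l b0 != 0 by apply: (point_weights_neq0 gen u4'); rewrite -(set3_rot a0).
  have nc : l c0 != 0 by apply: (point_weights_neq0 gen u4''); rewrite (set3_rot c0).
  have PI : [set y; d]%SET \in finset.cover P.
    apply: (no_point_inside u0 tP yd wl0); rewrite lt_neqAle eq_sym ?na ?nb ?nc /= leNgt;
      apply/negP => h; apply: nl; by [constructor 1|constructor 2|constructor 3].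
  have := excess_cover tP PI; rewrite excess_white // addrAC subrr add0r leNgt neg //.
have [a [b [c [uq et' es la]]]] := @white_wlog y a0 b0 c0 (fun p => l p < 0) u0 l0.
have et := etrans et0 et'; have wl := wl0; rewrite es in wl => {et0 et' es wl0 u0 a0 b0 c0 l0}.
rewrite {}et in tP td hmin neg descend notin; have [pa pb pc] := pow_white gen uq.
have tK : [set y; a]%SET \in white_triangle y a b c by rewrite !inE eqxx.
have hq : conv_hull (midpoints A) (mid [set y; d]%SET).
  by apply: sub_conv_hull; apply: midpoints_mid; rewrite cards2 yd.
have [|u [uP ut tu]] := neighbour hP tP tK hq (mid_white uq yd wl); first by rewrite eqxx.
have [qb qc qa cases] := white_adjacent uq tP uP ut tu.
apply: (descend _ uP).
  case: cases => [->|[e ue ->]]; rewrite /core ?core_white // ?inE 1?eq_sym //.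
  rewrite core_black ?inE //; move: uq; rewrite uniq4 uniq3.
  by move=> /and5P[_ -> -> _ /andP[_ ->]].
have := pow_weights (uniq4_tail uq) wl (C := circ u) (C' := circ (white_triangle y a b c)).
rewrite pb pc qb qc pa subr0 => /(_ erefl erefl) ->.
by rewrite gtrDl nmulr_rlt0.
Qed.

Lemma sub_order2_delaunay : P \subset order2_delaunay A.
Proof.
apply/fintype.subsetP => t tP; rewrite inE; apply/asboolP.
have [[a [b [c [u et]]]]|[y [a [b [c [u et]]]]]] := triangle_labelled hP tP.
  left; exists a, b, c; split=> // p; rewrite et in tP; have [pa pb pc] := pow_black gen u.
  move/(inside_pow gen p u pa pb pc); rewrite ltNge pow_outside //.
  by rewrite /core core_black // inE.
right; exists a, b, c, y; split=> //; first exact: uniq4_tail u.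
move=> p; rewrite et in tP; have [pa pb pc] := pow_white gen u.
rewrite (inside_pow gen p (uniq4_tail u) pa pb pc); split=> [|->]; last exact: pow_core_neg.
move=> lt0; apply/eqP; apply: contraTT lt0 => py; rewrite -leNgt pow_outside //.
by rewrite /core core_white // inE.
Qed.

End LocalToGlobal.

(** The vertex opposite a shared edge is not a vertex of the other triangle, and by
    [delaunay_excess] the excess is zero only at vertices of the triangle. *)
Lemma delaunay_local_angle (R : realType) (A : {fset 'rV[R]_2}) :
  generic A -> is_hypertriangulation (order2_delaunay A) ->
  local_angle_property (order2_delaunay A).
Proof.
move=> gen hP; apply/(local_angle_excess gen hP) => s t I J K L sP tP [st us ut es et].
have tL : L \in t by rewrite et !inE eqxx orbT.
have [ge0 e0] := delaunay_excess gen sP (labelled_card (triangle_labelled hP tP) tL).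
rewrite lt_def ge0 andbT; apply/eqP => /e0.
rewrite es !inE -orbA => /or3P[] /eqP E; move: ut.
- by rewrite E /= !inE eqxx orbT.
- by rewrite E /= !inE eqxx andbF.
by case: st; rewrite es et E.
Qed.

Theorem theorem5p4 (R : realType) (A : {fset 'rV[R]_2})
    (P2 : {set {set {set A}}}) :
  generic A -> (3 <= #|` A|)%N -> maximal_hypertriangulation P2 ->
  (local_angle_property P2 <-> P2 = order2_delaunay A).
Proof.
move=> gen _ maxP; split=> [lap|e].
  by apply: (sub_delaunay_eq gen maxP.1); apply: sub_order2_delaunay.
by rewrite e in maxP *; apply: delaunay_local_angle maxP.1.
Qed.
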